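(* Let $d\ge2$, let $\mu\ge0$ be a finite measure with compact support in $\mathbb{R}^d$, and let $\lambda,\varepsilon>0$, $p\ge1$. Then $\mathcal{E}_\mu^{\lambda,\varepsilon,p}$ admits a minimizer in $\mathcal{C}$.
   Context: $\mathcal{C}$ denotes the set of curves $\varphi:[0,a]\to\mathbb{R}^d$, $a\ge 0$, that are Lipschitz with $|\varphi'|=1$ a.e.; the length $L(\varphi)$ is its total variation, which equals $a$. $\Gamma_\varphi$ is the image of $\varphi$, $d(x,\Gamma)=\inf_{y\in\Gamma}|x-y|$, and $\kappa_\varphi=\varphi''$. The functional is $\mathcal{E}_\mu^{\lambda,\varepsilon,p}(\varphi)=\int d(x,\Gamma_\varphi)^p\,d\mu+\lambda L(\varphi)+\varepsilon\int_0^{L(\varphi)}|\kappa_\varphi|^2dt$ if $\varphi\in H^2([0,L(\varphi)];\mathbb{R}^d)\cap\mathcal{C}$ and $+\infty$ otherwise (a single-point curve has curvature term $0$). *)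

(* Defs.v *)
From HB Require Import structures.
From mathcomp Require Import all_boot all_order all_algebra.
From mathcomp Require Import all_classical all_reals all_analysis.
Set Implicit Arguments. Unset Strict Implicit. Unset Printing Implicit Defensive.
Import Order.TTheory GRing.Theory Num.Theory numFieldNormedType.Exports.
Local Open Scope classical_set_scope.
Local Open Scope ring_scope.

Definition enorm (R : realType) (d : nat) (x : 'rV[R]_d) : R :=
  Num.sqrt (\sum_(i < d) x ord0 i ^+ 2).

(* Borel sigma-algebra on R^d (generated by the open sets; the product
   topology on 'rV[R]_d coincides with the Euclidean one). *)
Definition BorelE (R : realType) (d : nat) :=
  g_sigma_algebraType (@open 'rV[R]_d).

Definition distS (R : realType) (d : nat) (x : 'rV[R]_d) (G : set 'rV[R]_d) : R :=
  inf [set enorm (x - y) | y in G].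

Definition curve_image (R : realType) (d : nat) (a : R) (phi : R -> 'rV[R]_d) :=
  phi @` `[0%R, a].

Definition inC (R : realType) (d : nat) (a : R) (phi : R -> 'rV[R]_d) : Prop :=
  0 <= a /\
  (exists L : R, forall s t, 0 <= s <= a -> 0 <= t <= a ->
      enorm (phi s - phi t) <= L * `|s - t|) /\
  {ae (@lebesgue_measure R), forall t, 0 < t < a ->
      derivable phi t 1 /\ enorm ('D_1 phi t) = 1}.

(* H^2 witness on [0,a]: phi(t) = phi(0) + int_0^t v, v(t) = v(0) + int_0^t kappa,
   with kappa measurable and square integrable on [0,a]
   (the absolutely continuous representative of an H^2 function; then
   v = phi' and kappa = phi'' a.e.). *)
Definition H2wit (R : realType) (d : nat) (a : R) (phi v kappa : R -> 'rV[R]_d) : Prop :=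
  (forall j : 'I_d, measurable_fun `[0%R, a] (fun t => kappa t ord0 j)) /\
  (\int[@lebesgue_measure R]_(t in `[0%R, a]) ((enorm (kappa t)) ^+ 2)%:E < +oo)%E /\
  (forall t, 0 <= t <= a -> forall j : 'I_d,
      v t ord0 j = v 0 ord0 j + Rintegral (@lebesgue_measure R) `[0%R, t] (fun s => kappa s ord0 j)) /\
  (forall t, 0 <= t <= a -> forall j : 'I_d,
      phi t ord0 j = phi 0 ord0 j + Rintegral (@lebesgue_measure R) `[0%R, t] (fun s => v s ord0 j)).

Definition inH2 (R : realType) (d : nat) (a : R) (phi : R -> 'rV[R]_d) : Prop :=
  exists v kappa, H2wit a phi v kappa.

(* int_0^a |kappa_phi|^2 dt ; all witnesses kappa agree a.e., so the infimum is
   the common value (and +oo if phi is not H^2). *)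
Definition curv_energy (R : realType) (d : nat) (a : R) (phi : R -> 'rV[R]_d) : \bar R :=
  ereal_inf [set (\int[@lebesgue_measure R]_(t in `[0%R, a]) ((enorm (kappa t)) ^+ 2)%:E)%E
            | kappa in [set kappa | exists v, H2wit a phi v kappa]].

Definition Energy (R : realType) (d : nat) (mu : {measure set (BorelE R d) -> \bar R})
  (lam eps p : R) (a : R) (phi : R -> 'rV[R]_d) : \bar R :=
  if `[< inC a phi /\ inH2 a phi >] then
    (\int[mu]_(x in [set: BorelE R d])
        ((distS (x : 'rV[R]_d) (curve_image a phi)) `^ p)%:E
     + (lam * a)%:E + eps%:E * curv_energy a phi)%E
  else +oo%E.

(* Main.v *)
Require Import Defs.
From HB Require Import structures.
From mathcomp Require Import all_boot all_order all_algebra.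
From mathcomp Require Import all_classical all_reals all_analysis.
From mathcomp Require Import measurable_realfun ring lra.
Import Order.TTheory GRing.Theory Num.Theory numFieldNormedType.Exports.
Local Open Scope classical_set_scope.
Local Open Scope ring_scope.

(* The direct method, with limits taken along an ultrafilter on [nat] instead of
   subsequences. Along a minimizing sequence the lengths [a_n], the curvature
   energies and the starting points are bounded, and unit-speed curves with
   bounded curvature energy have 1/2-Hölder tangents, so curves (1-Lipschitz) and
   tangents, extended to all times by clamping to [0, a_n], converge uniformly.
   The limit tangent is unit and is the derivative of the limit curve because the
   second-order Taylor estimate
     |phi t - phi s - (t - s) v r|^2 <= K (t - s)^3,  s <= r <= t,
   passes to the limit. The curvature of the limit, with the lower semicontinuous
   energy bound, comes from a minimal-norm argument in L^2 based on the
   parallelogram identity, in place of weak compactness. *)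

Set Implicit Arguments.
Unset Strict Implicit.

(** * Square integrable functions on an interval *)

(** The lengths vary along the sequence, so neither the curves nor their curvatures live on one
    interval. Clamping puts the curves on a common time axis, and extension by zero does the same
    for the curvatures. One fixed ultrafilter yields, by compactness alone, limits at all times and
    of all numerical quantities at once, with no diagonal extraction. Hölder bounds are kept
    squared, so that constants never involve square roots and the inequalities pass to the limit as
    they stand.

    Lower semicontinuity is used in a weak form: the fidelities, lengths and curvature energies of
    the approximants converge along the ultrafilter to numbers whose weighted sum is at most the
    infimum, and the limit curve does no worse than each of them. Starting points are controlled
    only when the measure is nonzero; the zero measure is settled by a single point. *)

Definition sqintegrable (R : realType) (D : set R) (f : R -> R) : Prop :=
  measurable_fun D f /\
  (@lebesgue_measure R).-integrable D (EFin \o (fun t => f t ^+ 2)).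

Definition energy (R : realType) (d : nat) (D : set R) (k : 'I_d -> R -> R) : R :=
  \sum_(j < d) \int[@lebesgue_measure R]_(t in D) (k j t ^+ 2).

Lemma lebesgue_itvcc_lty (R : realType) (s t : R) :
  (@lebesgue_measure R `[s, t] < +oo)%E.
Proof. by rewrite lebesgue_measure_itv/=; case: ifP => // _; rewrite -EFinB ltry. Qed.

Lemma integrable_cst_itv (R : realType) (s t c : R) :
  (@lebesgue_measure R).-integrable `[s, t] (EFin \o (fun=> c)).
Proof.
apply: measurable_bounded_integrable => //; first exact: lebesgue_itvcc_lty.
by exists `|c|; split=> [|M cM x _ /=]; [exact: num_real|exact: ltW].
Qed.

Lemma Rintegral_cst_itv (R : realType) (s t c : R) : s <= t ->
  \int[@lebesgue_measure R]_(x in `[s, t]) c = c * (t - s).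
Proof.
move=> st; rewrite Rintegral_cst//= lebesgue_measure_itv/= lte_fin.
by move: st; rewrite le_eqVlt => /predU1P[->|->]//; rewrite ltxx subrr.
Qed.

Lemma integrable_le_itv (R : realType) (s t : R) (f g : R -> R) :
  measurable_fun `[s, t] f -> (forall x, `[s, t]%classic x -> `|f x| <= g x) ->
  (@lebesgue_measure R).-integrable `[s, t] (EFin \o g) ->
  (@lebesgue_measure R).-integrable `[s, t] (EFin \o f).
Proof.
move=> mf fg ig; apply: (le_integrable _ _ _ ig) => //; first exact/measurable_EFinP.
by move=> x /fg h /=; rewrite lee_fin (le_trans h)// ler_norm.
Qed.

Lemma integrableD_itv (R : realType) (s t : R) (f g : R -> R) :
  (@lebesgue_measure R).-integrable `[s, t] (EFin \o f) ->
  (@lebesgue_measure R).-integrable `[s, t] (EFin \o g) ->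
  (@lebesgue_measure R).-integrable `[s, t] (EFin \o (fun x => f x + g x)).
Proof. by move=> f1 g1; exact: (integrableD _ f1 g1). Qed.

Lemma integrableM_itv (R : realType) (s t c : R) (f : R -> R) :
  (@lebesgue_measure R).-integrable `[s, t] (EFin \o f) ->
  (@lebesgue_measure R).-integrable `[s, t] (EFin \o (fun x => c * f x)).
Proof. by move=> f1; exact: (integrableZl _ c f1). Qed.

(** On a bounded interval [1 + f^2] is integrable and dominates [|f|]. *)
Lemma sqintegrable_integrable (R : realType) (s t : R) (f : R -> R) :
  sqintegrable `[s, t] f -> (@lebesgue_measure R).-integrable `[s, t] (EFin \o f).
Proof.
move=> [mf f2].
apply: integrable_le_itv (integrableD_itv (integrable_cst_itv s t 1) f2) => //.
by move=> x _; rewrite ler_norml; apply/andP; split; nra.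
Qed.

Lemma sqintegrableS (R : realType) (s t s' t' : R) (f : R -> R) :
  s <= s' -> t' <= t -> sqintegrable `[s, t] f -> sqintegrable `[s', t'] f.
Proof.
move=> ss tt [mf f2].
have st : `[s', t'] `<=` `[s, t] by apply: subset_itv; rewrite bnd_simp.
by split; [exact: measurable_funS mf|exact: integrableS f2].
Qed.

Lemma sqintegrableD (R : realType) (s t : R) (f g : R -> R) :
  sqintegrable `[s, t] f -> sqintegrable `[s, t] g ->
  sqintegrable `[s, t] (fun x => f x + g x).
Proof.
move=> [mf f2] [mg g2]; split; first exact: measurable_funD.
apply: integrable_le_itv (integrableM_itv 2 (integrableD_itv f2 g2)).
  by apply/measurable_funX/measurable_funD.
by move=> x _; rewrite ger0_norm ?sqr_ge0//; have := sqr_ge0 (f x - g x); nra.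
Qed.

Lemma sqintegrableZ (R : realType) (s t : R) (c : R) (f : R -> R) :
  sqintegrable `[s, t] f -> sqintegrable `[s, t] (fun x => c * f x).
Proof.
move=> [mf f2]; split; first exact: measurable_funM.
by apply: eq_integrable (integrableM_itv (c ^+ 2) f2) => // x _ /=; rewrite exprMn.
Qed.

Lemma sqintegrableB (R : realType) (s t : R) (f g : R -> R) :
  sqintegrable `[s, t] f -> sqintegrable `[s, t] g ->
  sqintegrable `[s, t] (fun x => f x - g x).
Proof.
move=> mf mg; have -> : (fun x => f x - g x) = (fun x => f x + (-1) * g x).
  by apply/funext => x; rewrite mulN1r.
by apply: sqintegrableD => //; exact: sqintegrableZ.
Qed.

Lemma sqintegrable_bounded (R : realType) (s t c : R) (f : R -> R) :
  measurable_fun `[s, t] f -> (forall x, `[s, t]%classic x -> `|f x| <= c) ->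
  sqintegrable `[s, t] f.
Proof.
move=> mf fc; split=> //.
apply: integrable_le_itv (integrable_cst_itv s t (c ^+ 2)).
  exact: measurable_funX.
move=> x /fc fxc /=; rewrite ger0_norm ?sqr_ge0//.
by rewrite -real_normK ?num_real// lerXn2r ?nnegrE// (le_trans _ fxc).
Qed.

Lemma energy_ge0 (R : realType) (d : nat) (D : set R) (k : 'I_d -> R -> R) :
  0 <= energy D k.
Proof. by apply: sumr_ge0 => j _; apply: Rintegral_ge0 => t _; exact: sqr_ge0. Qed.

(** Written with the midpoint because midpoints stay in a convex set, where the subtracted term is
    bounded below by the infimum of the energy. *)
Lemma Rintegral_sqr_parallelogram (R : realType) (s t : R) (f g : R -> R) :
  sqintegrable `[s, t] f -> sqintegrable `[s, t] g ->
  \int[@lebesgue_measure R]_(x in `[s, t]) ((f x - g x) ^+ 2) =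
    2 * \int[@lebesgue_measure R]_(x in `[s, t]) (f x ^+ 2) +
    2 * \int[@lebesgue_measure R]_(x in `[s, t]) (g x ^+ 2) -
    4 * \int[@lebesgue_measure R]_(x in `[s, t]) ((2^-1 * (f x + g x)) ^+ 2).
Proof.
move=> hf hg.
have [_ iB] := sqintegrableB hf hg.
have [_ iM] := sqintegrableZ 2^-1 (sqintegrableD hf hg).
have [_ i1] := hf; have [_ i2] := hg.
apply/eqP; rewrite eq_sym subr_eq eq_sym; apply/eqP.
rewrite -!RintegralZl// -!RintegralD//; try exact: integrableM_itv.
by apply: eq_Rintegral => x _; field.
Qed.

(** Integrate [2 c f <= f^2 + c^2] and take for [c] the mean of [f]; the one-point interval, which
    has no mean, is treated apart. *)
Lemma cauchy_schwarz_itv (R : realType) (s t : R) (f : R -> R) :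
  s <= t -> sqintegrable `[s, t] f ->
  (\int[@lebesgue_measure R]_(x in `[s, t]) f x) ^+ 2 <=
    (t - s) * \int[@lebesgue_measure R]_(x in `[s, t]) (f x ^+ 2).
Proof.
move=> st hf.
have fi := sqintegrable_integrable hf.
pose I := \int[@lebesgue_measure R]_(x in `[s, t]) f x.
pose J := \int[@lebesgue_measure R]_(x in `[s, t]) (f x ^+ 2).
rewrite -/I -/J.
have key c : 2 * c * I <= J + c ^+ 2 * (t - s).
  rewrite /I /J -RintegralZl// -(Rintegral_cst_itv _ st) -RintegralD//; last 2 first.
    exact: hf.2.
    exact: integrable_cst_itv.
  apply: le_Rintegral => //.
  - exact: integrableM_itv.
  - exact: (integrableD_itv hf.2 (integrable_cst_itv s t (c ^+ 2))).
  - by move=> x _; have := sqr_ge0 (f x - c); nra.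
move: st; rewrite le_eqVlt => /predU1P[st|st].
  by rewrite /I st set_itv1 Rintegral_set1 expr0n/= subrr mul0r.
have := key (I / (t - s)).
have ts : t - s != 0 by rewrite subr_eq0 gt_eqF.
have -> : 2 * (I / (t - s)) * I = 2 * (I ^+ 2 / (t - s)) by field.
have -> : (I / (t - s)) ^+ 2 * (t - s) = I ^+ 2 / (t - s) by field.
move=> h; have {h} : I ^+ 2 / (t - s) <= J by lra.
by rewrite ler_pdivrMr ?subr_gt0// mulrC.
Qed.

Lemma sqintegrable_normr (R : realType) (s t : R) (f : R -> R) :
  sqintegrable `[s, t] f -> sqintegrable `[s, t] (fun x => `|f x|).
Proof.
move=> [mf f2]; split; first exact: measurableT_comp.
by apply: eq_integrable f2 => // x _ /=; rewrite real_normK ?num_real.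
Qed.

Lemma integral_itv_fine (R : realType) (s t : R) (f : R -> R) :
  (@lebesgue_measure R).-integrable `[s, t] (EFin \o f) ->
  (\int[@lebesgue_measure R]_(x in `[s, t]) (f x)%:E)%E =
  (\int[@lebesgue_measure R]_(x in `[s, t]) f x)%:E.
Proof. by move=> fi; rewrite /Rintegral fineK//; exact: integrable_fin_num. Qed.

(** * Limits of rapidly Cauchy sequences in L^2 *)

Lemma sum_geometric_half_le (R : realType) (c : R) (n : nat) :
  0 <= c -> \sum_(0 <= i < n) c * 2^-1 ^+ i <= 2 * c.
Proof.
move=> c0; suff : \sum_(0 <= i < n) c * 2^-1 ^+ i <= 2 * c - 2 * c * 2^-1 ^+ n.
  have p : 0 <= 2^-1 ^+ n :> R by rewrite exprn_ge0 ?invr_ge0.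
  by move=> h; apply: le_trans h _; nra.
elim: n => [|n ih]; first by rewrite big_geq// expr0 mulr1 subrr.
rewrite big_nat_recr//= exprS; set x := 2^-1 ^+ n in ih *.
apply: le_trans (lerD ih (lexx _)) _.
by rewrite le_eqVlt; apply/orP; left; apply/eqP; field.
Qed.

Lemma ae_imply (R : realType) (P Q : R -> Prop) : (forall x, P x -> Q x) ->
  {ae @lebesgue_measure R, forall x, P x} -> {ae @lebesgue_measure R, forall x, Q x}.
Proof.
move=> PQ [N [mN N0 PN]]; exists N; split=> // x /= nQ.
by apply: PN => /= /PQ.
Qed.

(* The telescoping series converges absolutely a.e. because the sum of the
   L^1 norms of the increments is finite; that sum is also the dominating
   function. *)
Lemma sqintegrable_fast_cauchy (R : realType) (a M : R) (f : nat -> R -> R) :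
  0 <= a ->
  (forall n, sqintegrable `[0, a] (f n)) ->
  (forall n, \int[@lebesgue_measure R]_(x in `[0%R, a]) (f n x ^+ 2) <= M) ->
  (forall n, \int[@lebesgue_measure R]_(x in `[0%R, a]) ((f n.+1 x - f n x) ^+ 2)
     <= (2^-1 ^+ n) ^+ 2) ->
  exists g, [/\ sqintegrable `[0, a] g,
    forall t, 0 <= t <= a ->
      \int[@lebesgue_measure R]_(x in `[0%R, t]) f n x @[n --> \oo] -->
      \int[@lebesgue_measure R]_(x in `[0%R, t]) g x &
    forall e, 0 < e -> \forall n \near \oo,
      \int[@lebesgue_measure R]_(x in `[0%R, a]) (g x ^+ 2) <=
      \int[@lebesgue_measure R]_(x in `[0%R, a]) (f n x ^+ 2) + e].
Proof.
move=> a0 hf fM fc.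
have df n : sqintegrable `[0, a] (fun x => `|f n.+1 x - f n x|).
  by apply: sqintegrable_normr; apply: sqintegrableB.
(* Cauchy-Schwarz gives the factor [sqrt a]; [a + 1] replaces it, since [a <= (a + 1)^2]. *)
have df1 n : \int[@lebesgue_measure R]_(x in `[0%R, a]) `|f n.+1 x - f n x| <=
    (a + 1) * 2^-1 ^+ n.
  rewrite -(@ler_sqr R) ?nnegrE; last 2 first.
    by apply: Rintegral_ge0.
    by rewrite mulr_ge0 ?addr_ge0// exprn_ge0 ?invr_ge0.
  apply: le_trans (cauchy_schwarz_itv a0 (df n)) _.
  rewrite subr0; under eq_Rintegral do rewrite real_normK ?num_real//.
  apply: le_trans (ler_wpM2l a0 (fc n)) _.
  by rewrite exprMn ler_wpM2r ?sqr_ge0//; nra.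
pose h n x := (`|f n.+1 x - f n x|)%:E.
pose H x := (\sum_(n <oo) h n x)%E.
have h0 n x : (0 <= h n x)%E by rewrite lee_fin.
have mh n : measurable_fun `[0, a] (h n) by apply/measurable_EFinP; exact: (df n).1.
have mH : measurable_fun `[0, a] H.
  by apply: ge0_emeasurable_sum => // n x _ _; exact: h0.
have H0 x : (0 <= H x)%E by apply: nneseries_ge0.
have iH : (@lebesgue_measure R).-integrable `[0, a] H.
  apply/integrableP; split=> //.
  under eq_integral do rewrite gee0_abs//.
  rewrite /H integral_nneseries//.
  apply: (@le_lt_trans _ _ (2 * (a + 1))%:E); last exact: ltry.
  apply: lime_le; first by apply: is_cvg_nneseries => n _ _; apply: integral_ge0.
  apply: nearW => n.
  apply: (@le_trans _ _ (\sum_(0 <= i < n) (((a + 1) * 2^-1 ^+ i)%:E))%E).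
    apply: lee_sum => i _; rewrite /h integral_itv_fine ?lee_fin//.
    exact: sqintegrable_integrable.
  by rewrite sumEFin lee_fin sum_geometric_half_le// addr_ge0.
have Hfin : {ae @lebesgue_measure R, forall x, `[0, a]%classic x -> H x \is a fin_num}.
  exact: integrable_ae.
have cvgf x : H x \is a fin_num -> cvgn (fun n => f n x).
  move=> Hx.
  have : cvgn (series (fun n => f n.+1 x - f n x)).
    apply: normed_cvg; apply: nondecreasing_is_cvgn.
      move=> m n mn; rewrite /series/= -subr_ge0 sub_series_geq//.
      exact: sumr_ge0.
    exists (fine (H x)) => _ [n _ <-].
    rewrite -lee_fin fineK// /series/= -sumEFin.
    exact: nneseries_lim_ge.
  rewrite (_ : series _ = (fun n => f n x - f 0%N x)); last first.
    by apply/funext => n; rewrite /series/= telescope_sumr.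
  move=> c; rewrite (_ : (fun n => f n x) = (fun n => f n x - f 0%N x) + cst (f 0%N x)).
    by apply: is_cvgD => //; exact: is_cvg_cst.
  by apply/funext => n; rewrite !fctE subrK.
have fbound n x : (`|(f n x)%:E| <= (`|f 0%N x|)%:E + H x)%E.
  apply: (@le_trans _ _ ((`|f 0%N x|)%:E + \sum_(0 <= i < n) h i x)%E).
    rewrite /h sumEFin -EFinD /= lee_fin.
    rewrite -{1}(subrK (f 0%N x) (f n x)) -(@telescope_sumr _ 0 n (f ^~ x))//.
    rewrite addrC; apply: le_trans (ler_normD _ _) _.
    by rewrite lerD2l ler_norm_sum.
  by apply: leeD2l; exact: nneseries_lim_ge.
(* The upper limit is measurable without any convergence hypothesis and equals the limit wherever
   [H] is finite; [fine] supplies a real value on the remaining null set. *)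
pose g x := fine (limn_esup (fun n => (f n x)%:E)).
have mg : measurable_fun `[0, a] g.
  apply: measurableT_comp; first exact: fine_measurable.
  apply: measurable_fun_limn_esup => n; apply/measurable_EFinP; exact: (hf n).1.
have fg x : H x \is a fin_num -> f n x @[n --> \oo] --> g x.
  move=> /cvgf fx.
  have /cvg_limn_einf_sup[_ e] : (fun n => (f n x)%:E) @ \oo --> (limn (fun n => f n x))%:E.
    by apply: cvg_EFin => //; exact: nearW.
  by rewrite /g e.
have cg : {ae @lebesgue_measure R, forall x, `[0, a]%classic x -> f n x @[n --> \oo] --> g x}.
  by apply: ae_imply Hfin => x Hx /Hx; exact: fg.
(* Fatou for the squares; it serves twice, for the square integrability of [g] and for the last
   conclusion. *)
have g2 : (\int[@lebesgue_measure R]_(x in `[0%R, a]) (g x ^+ 2)%:E <=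
  limn_einf (fun n => (\int[@lebesgue_measure R]_(x in `[0%R, a]) (f n x ^+ 2))%:E))%E.
  have -> : (\int[@lebesgue_measure R]_(x in `[0%R, a]) (g x ^+ 2)%:E =
    \int[@lebesgue_measure R]_(x in `[0%R, a]) limn_einf (fun n => (f n x ^+ 2)%:E))%E.
    apply: ae_eq_integral => //.
    - by apply/measurable_EFinP/measurable_funX.
    - rewrite (_ : (fun x => _) =
          -%E \o (fun x => limn_esup (fun n => - (f n x ^+ 2)%:E)%E))//.
      apply: measurableT_comp => //; apply: measurable_fun_limn_esup => n.
      apply: measurableT_comp => //; apply/measurable_EFinP/measurable_funX.
      exact: (hf n).1.
    - apply: ae_imply cg => x xg /xg cx.
      have /cvg_limn_einf_sup[-> _] // : (fun n => (f n x ^+ 2)%:E) @ \oo --> (g x ^+ 2)%:E.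
      by apply: cvg_EFin; [exact: nearW|exact: (cvgM cx cx)].
  rewrite (_ : (fun n => (Rintegral _ _ _)%:E) =
      (fun n => \int[@lebesgue_measure R]_(x in `[0%R, a]) (f n x ^+ 2)%:E)%E); last first.
    by apply/funext => n; rewrite integral_itv_fine//; exact: (hf n).2.
  have F := @fatou _ _ R (@lebesgue_measure R) `[0%R, a] (measurable_itv _)
    (fun n x => (f n x ^+ 2)%:E).
  apply: F => [n|n x _]; last by rewrite lee_fin sqr_ge0.
  by apply/measurable_EFinP/measurable_funX; exact: (hf n).1.
have g2M : (\int[@lebesgue_measure R]_(x in `[0%R, a]) (g x ^+ 2)%:E <= M%:E)%E.
  apply: le_trans g2 _; rewrite limn_einf_lim; apply: lime_le; first exact: is_cvg_einfs.
  apply: nearW => n.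
  apply: (@le_trans _ _
      (\int[@lebesgue_measure R]_(x in `[0%R, a]) (f n x ^+ 2))%:E).
    by apply: ereal_inf_lbound; exists n => /=.
  by rewrite lee_fin.
have sg : sqintegrable `[0, a] g.
  split=> //; apply/integrableP; split; first exact/measurable_EFinP/measurable_funX.
  apply: le_lt_trans (ltry M); apply: le_trans g2M.
  by under eq_integral do rewrite /= ger0_norm ?sqr_ge0//.
exists g; split => //.
- move=> t /andP[t0 ta].
  have s0a : `[0, t] `<=` `[0, a] by apply: subset_itvl; rewrite bnd_simp.
  have iG : (@lebesgue_measure R).-integrable `[0, t] (fun x => (`|f 0%N x|)%:E + H x)%E.
    have i0 := sqintegrable_integrable (sqintegrable_normr (hf 0%N)).
    have iGa : (@lebesgue_measure R).-integrable `[0%R, a]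
      (fun x => (`|f 0%N x|)%:E + H x)%E by exact: (integrableD _ i0 iH).
    exact: integrableS iGa.
  have m1 n : measurable_fun `[0%R, t] (EFin \o f n).
    by apply/measurable_EFinP; apply: measurable_funS (hf n).1.
  have m2 : measurable_fun `[0%R, t] (EFin \o g).
    by apply/measurable_EFinP; apply: measurable_funS mg.
  have c1 : {ae @lebesgue_measure R, forall x, `[0%R, t]%classic x ->
      (EFin \o f n) x @[n --> \oo] --> (EFin \o g) x}.
    by apply: ae_imply cg => x cx xt; apply: cvg_EFin; [exact: nearW|exact/cx/s0a].
  have b1 : {ae @lebesgue_measure R, forall x n, `[0%R, t]%classic x ->
      (`|(EFin \o f n) x| <= (`|f 0%N x|)%:E + H x)%E}.
    by apply: aeW => x n _; exact: fbound.
  have [_ _ dc] := @dominated_convergence _ _ R (@lebesgue_measure R) _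
    (measurable_itv _) _ _ _ m1 m2 c1 iG b1.
  have : (fun n => (\int[@lebesgue_measure R]_(x in `[0%R, t]) f n x)%:E) @ \oo -->
      (\int[@lebesgue_measure R]_(x in `[0%R, t]) g x)%:E.
    rewrite -integral_itv_fine; last exact/sqintegrable_integrable/(sqintegrableS _ ta sg).
    apply: cvg_trans dc; apply: near_eq_cvg; apply: nearW => n /=.
    by rewrite integral_itv_fine//; exact/sqintegrable_integrable/(sqintegrableS _ ta (hf n)).
  by move=> /fine_cvgP[].
- move=> e e0.
  set I := Rintegral _ _ _.
  (* The lower limit is the supremum of the tail infima, so one tail infimum already exceeds
     [I - e], and with it all later terms. *)
  have : ((I - e)%:E < ereal_sup (range (einfs (fun n =>
      (\int[@lebesgue_measure R]_(x in `[0%R, a]) (f n x ^+ 2))%:E))))%E.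
    rewrite -(cvg_lim _ (@cvg_einfs_sup R _))// -limn_einf_lim.
    apply: lt_le_trans g2; rewrite integral_itv_fine; last exact: sg.2.
    by rewrite lte_fin -/I gtrBl.
  move=> /ereal_sup_gt[_ [n _ <-] ltn].
  exists n => // m /= nm.
  have : ((I - e)%:E < (\int[@lebesgue_measure R]_(x in `[0%R, a]) (f m x ^+ 2))%:E)%E.
    by apply: lt_le_trans ltn _; apply: ereal_inf_lbound; exists m.
  by rewrite lte_fin ltrBlDr => /ltW.
Qed.

(** * Curvature of the limit by minimal norm *)

Definition primitive_within (R : realType) (d : nat) (a : R) (W k : 'I_d -> R -> R)
  (e : R) : Prop :=
  (forall j, sqintegrable `[0%R, a] (k j)) /\
  forall j t, 0 <= t <= a ->
    `|\int[@lebesgue_measure R]_(x in `[0%R, t]) k j x - W j t| <= e.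

Lemma primitive_within_mean (R : realType) (d : nat) (a : R)
  (W k1 k2 : 'I_d -> R -> R) (e : R) :
  primitive_within a W k1 e -> primitive_within a W k2 e ->
  primitive_within a W (fun j x => 2^-1 * (k1 j x + k2 j x)) e.
Proof.
move=> [L1 P1] [L2 P2]; split.
  by move=> j; apply: sqintegrableZ; exact: sqintegrableD.
move=> j t t0a; have /andP[t0 ta] := t0a.
have i1 := sqintegrable_integrable (sqintegrableS (lexx 0) ta (L1 j)).
have i2 := sqintegrable_integrable (sqintegrableS (lexx 0) ta (L2 j)).
rewrite RintegralZl//; last exact: integrableD_itv.
rewrite RintegralD//.
have := P1 j t t0a; have := P2 j t t0a.
rewrite !ler_norml => /andP[? ?] /andP[? ?]; apply/andP; split; lra.
Qed.

Lemma energy_parallelogram (R : realType) (d : nat) (s t : R) (k1 k2 : 'I_d -> R -> R) :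
  (forall j, sqintegrable `[s, t] (k1 j)) -> (forall j, sqintegrable `[s, t] (k2 j)) ->
  energy `[s, t] (fun j x => k1 j x - k2 j x) =
  2 * energy `[s, t] k1 + 2 * energy `[s, t] k2 -
  4 * energy `[s, t] (fun j x => 2^-1 * (k1 j x + k2 j x)).
Proof.
move=> h1 h2; rewrite /energy !mulr_sumr -big_split/= -sumrB.
by apply: eq_bigr => j _; rewrite Rintegral_sqr_parallelogram.
Qed.

Lemma Rintegral_le_energy (R : realType) (d : nat) (D : set R) (k : 'I_d -> R -> R) j :
  \int[@lebesgue_measure R]_(t in D) (k j t ^+ 2) <= energy D k.
Proof.
rewrite /energy (bigD1 j)//= lerDl; apply: sumr_ge0 => i _.
by apply: Rintegral_ge0 => t _; exact: sqr_ge0.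
Qed.

(* A substitute for weak L^2 compactness: near-minimal elements of the convex
   sets of functions whose primitive is uniformly [e]-close to [W] form a Cauchy
   sequence as [e] tends to 0, by the parallelogram identity. *)
Lemma exists_primitive_energy_le (R : realType) (d : nat) (a M : R)
  (W : 'I_d -> R -> R) : 0 <= a ->
  (forall e, 0 < e -> exists k, primitive_within a W k e /\
     energy `[0%R, a] k <= M + e) ->
  exists k, [/\ forall j, sqintegrable `[0%R, a] (k j),
    energy `[0%R, a] k <= M &
    forall j t, 0 <= t <= a ->
      \int[@lebesgue_measure R]_(x in `[0%R, t]) k j x = W j t].
Proof.
move=> a0 near_prim.
(* [S e] is stable under midpoints and nonempty for every [e > 0], although [W] is not yet known to
   be a primitive. *)
pose S e := [set k : 'I_d -> R -> R | primitive_within a W k e].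
pose I e := inf [set energy `[0%R, a] k | k in S e].
have SS e e' : e <= e' -> S e `<=` S e'.
  by move=> ee k [L P]; split=> // j t /(P j) h; exact: le_trans h ee.
have lbI e : has_lbound [set energy `[0%R, a] k | k in S e].
  by exists 0 => _ [k _ <-]; exact: energy_ge0.
have neI e : 0 < e -> [set energy `[0%R, a] k | k in S e] !=set0.
  by move=> /near_prim[k [Sk _]]; exists (energy `[0%R, a] k), k.
have Imono e e' : 0 < e -> e <= e' -> I e' <= I e.
  move=> e0 ee; apply: lb_le_inf; first exact: neI.
  by move=> _ [k /(SS _ _ ee) Sk <-]; apply: ge_inf => //; exists k.
have IM e : 0 < e -> I e <= M.
  move=> e0; apply/ler_addgt0Pr => h h0.
  have m0 : 0 < Num.min e h by rewrite lt_min e0.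
  have [k [Sk Mk]] := near_prim _ m0.
  apply: (@le_trans _ _ (energy `[0%R, a] k)).
    apply: ge_inf => //; exists k => //; apply: SS Sk.
    by rewrite ge_min lexx.
  by apply: le_trans Mk _; rewrite lerD2l ge_min lexx orbT.
(* Shrinking [e] shrinks [S e] and raises [I e], so [J] is the limit of the minimal energies as [e]
   tends to 0. *)
pose J := sup [set I e | e in [set e | 0 < e]].
have hJ : has_sup [set I e | e in [set e : R | 0 < e]].
  split; first by exists (I 1), 1 => //=.
  by exists M => _ [e e0 <-]; exact: IM.
have JM : J <= M by apply: ge_sup; [exact: hJ.1|move=> _ [e e0 <-]; exact: IM].
have IJ e : 0 < e -> I e <= J by move=> e0; apply: ub_le_sup; [exact: hJ.2|exists e].
pose z n : R := 2^-1 ^+ n.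
have z0 n : 0 < z n by rewrite exprn_gt0// invr_gt0.
have zS n : z n.+1 <= z n by rewrite /z exprS; have := z0 n; rewrite /z; lra.
(* The parallelogram identity bounds the increment energy by [2 h + 2 h + 4 h]: twice the excess of
   each of two near-minimizers, and four times the deficit of the midpoint. Dividing by 8 makes this
   [z n ^+ 2]. *)
pose h n : R := z n ^+ 2 / 8.
have h0 n : 0 < h n by rewrite divr_gt0// exprn_gt0.
have hS n : h n.+1 <= h n.
  rewrite /h ler_wpM2r ?invr_ge0//.
  by rewrite lerXn2r// nnegrE ltW.
have /choice[ke kP] n : exists ke : ('I_d -> R -> R) * R,
    [/\ 0 < ke.2, ke.2 <= z n, S ke.2 ke.1,
        energy `[0%R, a] ke.1 <= J + h n & J - h n < I ke.2].
  have [_ [e e0 <-] Je] := sup_adherent (h0 n) hJ.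
  pose e' := Num.min e (z n).
  have e'0 : 0 < e' by rewrite lt_min e0 z0.
  have [_ [k Sk <-] kI] := inf_adherent (h0 n) (conj (neI _ e'0) (lbI e')).
  exists (k, e') => /=; split => //.
  - by rewrite ge_min lexx orbT.
  - by apply: le_trans (ltW kI) _; rewrite lerD2r IJ.
  - by apply: lt_le_trans Je _; apply: Imono => //; rewrite ge_min lexx.
pose k n := (ke n).1.
have Lk n j : sqintegrable `[0%R, a] (k n j) by have [_ _ [L _] _ _] := kP n; exact: L.
have Ek n : energy `[0%R, a] (k n) <= J + h n by have [] := kP n.
have dk n : energy `[0%R, a] (fun j x => k n.+1 j x - k n j x) <= z n ^+ 2.
  rewrite energy_parallelogram//.
  (* At the larger tolerance both functions, hence their midpoint, are admissible; being one of the
     two chosen tolerances, it still satisfies [J - h n <= I e]. *)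
  pose e := Num.max (ke n).2 (ke n.+1).2.
  have [e0 ez Sn _ JI] := kP n; have [e0' ez' Sn' _ JI'] := kP n.+1.
  have JIe : J - h n <= I e.
    rewrite /e; case: (leP (ke n).2 (ke n.+1).2) => _; apply: ltW => //.
    by apply: le_lt_trans JI'; rewrite lerB.
  have Sm : S e (fun j x => 2^-1 * (k n.+1 j x + k n j x)).
    apply: primitive_within_mean; [apply: SS Sn'|apply: SS Sn];
      by rewrite /e le_max lexx ?orbT.
  have Im : I e <= energy `[0%R, a] (fun j x => 2^-1 * (k n.+1 j x + k n j x)).
    by apply: ge_inf => //; eexists; first exact: Sm.
  have := Ek n; have := Ek n.+1; have := hS n.
  have -> : z n ^+ 2 = 8 * h n by rewrite /h; field.
  lra.
have /choice[g gP] j : exists g, [/\ sqintegrable `[0%R, a] g,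
    forall t, 0 <= t <= a ->
      \int[@lebesgue_measure R]_(x in `[0%R, t]) k n j x @[n --> \oo] -->
      \int[@lebesgue_measure R]_(x in `[0%R, t]) g x &
    forall e, 0 < e -> \forall n \near \oo,
      \int[@lebesgue_measure R]_(x in `[0%R, a]) (g x ^+ 2) <=
      \int[@lebesgue_measure R]_(x in `[0%R, a]) (k n j x ^+ 2) + e].
  apply: (@sqintegrable_fast_cauchy _ _ (J + h 0%N)) => // n.
    apply: le_trans (Rintegral_le_energy _ _ _) _; apply: le_trans (Ek n) _.
    rewrite lerD2l; elim: n => // n ih; exact: le_trans (hS n) ih.
  by apply: le_trans (dk n); exact: (Rintegral_le_energy _ (fun j x => k n.+1 j x - k n j x)).
have zc : z n @[n --> \oo] --> (0 : R).
  by apply: cvg_expr; rewrite ger0_norm ?invr_ge0// invf_lt1// ltr1n.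
exists g; split.
- by move=> j; have [] := gP j.
- apply/ler_addgt0Pr => e e0.
  (* One share of the error for each of the [d] coordinates and one for the excess [h n]. *)
  pose e' := e / (d%:R + 1).
  have d1 : 0 < d%:R + 1 :> R by rewrite ltr_wpDl.
  have e'0 : 0 < e' by rewrite divr_gt0.
  have A : \forall n \near \oo, forall j : 'I_d,
      \int[@lebesgue_measure R]_(x in `[0%R, a]) (g j x ^+ 2) <=
      \int[@lebesgue_measure R]_(x in `[0%R, a]) (k n j x ^+ 2) + e'.
    by apply: filter_forall => j; have [_ _ ] := gP j; exact.
  have B : \forall n \near \oo, `|0 - z n| < Num.min 1 e'.
    by move/cvgrPdist_lt : zc; apply; rewrite lt_min ltr01.
  have [n [An Bn]] := filter_ex (filterI A B).
  apply: (@le_trans _ _ (energy `[0%R, a] (k n) + d%:R * e')).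
    rewrite -[X in X%:R * e']card_ord -sum1_card natr_sum mulr_suml -big_split/=.
    by apply: ler_sum => j _; rewrite mul1r.
  apply: le_trans (lerD (Ek n) (lexx _)) _.
  have : h n <= e'.
    move: Bn; rewrite sub0r normrN gtr0_norm// lt_min => /andP[z1 ze].
    by rewrite /h; have := z0 n; nra.
  have : (d%:R + 1) * e' = e by rewrite /e' mulrC divfK// gt_eqF.
  by rewrite mulrDl mul1r; lra.
- move=> j t t0a; have [_ cg _] := gP j.
  (* The primitives of [k n j] tend to that of [g j], and also to [W j t] because their tolerances
     are at most [z n]. *)
  apply: (cvg_unique _ (cg t t0a)) => //.
  apply/cvgrPdist_le => e e0.
  move/cvgrPdist_lt : zc => /(_ e e0); apply: filterS => n.
  rewrite sub0r normrN gtr0_norm// => ze.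
  have [_ ez [_ P] _ _] := kP n.
  by rewrite distrC; apply: le_trans (P j t t0a) _; apply: le_trans ez (ltW ze).
Qed.

(** * The Euclidean norm and Hölder curves *)

Lemma sqr_enorm (R : realType) (d : nat) (x : 'rV[R]_d) :
  enorm x ^+ 2 = \sum_(i < d) x ord0 i ^+ 2.
Proof. by rewrite sqr_sqrtr// sumr_ge0// => i _; exact: sqr_ge0. Qed.

Lemma enorm_ge0 (R : realType) (d : nat) (x : 'rV[R]_d) : 0 <= enorm x.
Proof. exact: sqrtr_ge0. Qed.

Lemma enorm_le (R : realType) (d : nat) (x : 'rV[R]_d) (c : R) :
  0 <= c -> (enorm x <= c) = (enorm x ^+ 2 <= c ^+ 2).
Proof. by move=> c0; rewrite ler_sqr// nnegrE enorm_ge0. Qed.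

Lemma enormZ (R : realType) (d : nat) (c : R) (x : 'rV[R]_d) :
  enorm (c *: x) = `|c| * enorm x.
Proof.
rewrite /enorm -sqrtr_sqr -sqrtrM ?sqr_ge0// mulr_sumr.
by congr Num.sqrt; apply: eq_bigr => i _; rewrite mxE exprMn.
Qed.

Lemma enormN (R : realType) (d : nat) (x : 'rV[R]_d) : enorm (- x) = enorm x.
Proof. by rewrite -scaleN1r enormZ normrN1 mul1r. Qed.

Lemma enormC (R : realType) (d : nat) (x y : 'rV[R]_d) : enorm (x - y) = enorm (y - x).
Proof. by rewrite -enormN opprB. Qed.

Lemma enorm0 (R : realType) (d : nat) : enorm (0 : 'rV[R]_d) = 0.
Proof. by rewrite -(scale0r 0) enormZ normr0 mul0r. Qed.

Lemma enorm_delta (R : realType) (d : nat) (i : 'I_d) :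
  enorm (delta_mx ord0 i : 'rV[R]_d) = 1.
Proof.
rewrite /enorm (bigD1 i)//= mxE !eqxx expr1n big1 ?addr0 ?sqrtr1// => j ji.
by rewrite mxE (negPf ji) andbF expr0n.
Qed.

Lemma coord_le_enorm (R : realType) (d : nat) (x : 'rV[R]_d) (i : 'I_d) :
  `|x ord0 i| <= enorm x.
Proof.
rewrite -ler_sqr ?nnegrE ?enorm_ge0// real_normK ?num_real// sqr_enorm.
by rewrite (bigD1 i)//= lerDl sumr_ge0// => j _; exact: sqr_ge0.
Qed.

Lemma norm_le_enorm (R : realType) (d : nat) (x : 'rV[R]_d) : `|x| <= enorm x.
Proof.
rewrite [leLHS]/Num.Def.normr/= mx_normrE.
apply: bigmax_le => [|[i j] _]; first exact: enorm_ge0.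
by rewrite (ord1 i) /=; exact: coord_le_enorm.
Qed.

(** Expand the sum of squares of [B x_i - A y_i] and divide by [A B], where [A] and [B] are the two
    norms; a zero norm forces zero coordinates. *)
Lemma dot_le_enorm (R : realType) (d : nat) (x y : 'rV[R]_d) :
  \sum_(i < d) x ord0 i * y ord0 i <= enorm x * enorm y.
Proof.
set A := enorm x; set B := enorm y.
have [A0|A0] := eqVneq A 0.
  rewrite A0 mul0r big1// => i _.
  have : `|x ord0 i| <= 0 by rewrite -A0; exact: coord_le_enorm.
  by rewrite normr_le0 => /eqP->; rewrite mul0r.
have [B0|B0] := eqVneq B 0.
  rewrite B0 mulr0 big1// => i _.
  have : `|y ord0 i| <= 0 by rewrite -B0; exact: coord_le_enorm.
  by rewrite normr_le0 => /eqP->; rewrite mulr0.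
have AB : 0 < A * B by rewrite mulr_gt0// lt_def ?A0 ?B0 enorm_ge0.
have : 0 <= \sum_(i < d) (B * x ord0 i - A * y ord0 i) ^+ 2.
  by apply: sumr_ge0 => i _; exact: sqr_ge0.
have -> : \sum_(i < d) (B * x ord0 i - A * y ord0 i) ^+ 2 =
   B ^+ 2 * (\sum_(i < d) x ord0 i ^+ 2) + A ^+ 2 * (\sum_(i < d) y ord0 i ^+ 2) -
   2 * (A * B) * \sum_(i < d) x ord0 i * y ord0 i.
  by rewrite !mulr_sumr -big_split/= -sumrB; apply: eq_bigr => i _; ring.
rewrite -!sqr_enorm -/A -/B => h.
by rewrite -(ler_pM2l AB); nra.
Qed.

Lemma enormD (R : realType) (d : nat) (x y : 'rV[R]_d) :
  enorm (x + y) <= enorm x + enorm y.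
Proof.
rewrite enorm_le ?addr_ge0 ?enorm_ge0// sqrrD !sqr_enorm.
have -> : \sum_(i < d) (x + y) ord0 i ^+ 2 = \sum_(i < d) x ord0 i ^+ 2 +
    \sum_(i < d) y ord0 i ^+ 2 + 2 * \sum_(i < d) x ord0 i * y ord0 i.
  by rewrite mulr_sumr -!big_split/=; apply: eq_bigr => i _; rewrite mxE; ring.
by have := dot_le_enorm x y; lra.
Qed.

Lemma enorm_triangle (R : realType) (d : nat) (x y z : 'rV[R]_d) :
  enorm (x - z) <= enorm (x - y) + enorm (y - z).
Proof. by have := enormD (x - y) (y - z); rewrite addrA subrK. Qed.

Lemma enorm_dist (R : realType) (d : nat) (x y : 'rV[R]_d) :
  `|enorm x - enorm y| <= enorm (x - y).
Proof.
have h1 := enormD (x - y) y; have h2 := enormD (y - x) x.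
by move: h1 h2; rewrite !subrK (enormC y) ler_norml => h1 h2; apply/andP; split; lra.
Qed.

Lemma continuous_enorm (R : realType) (d : nat) :
  continuous (@enorm R d : 'rV[R]_d -> R).
Proof.
move=> x; apply: (@continuous_comp _ _ _ (fun x : 'rV[R]_d => \sum_(i < d) x ord0 i ^+ 2)
   Num.sqrt); last exact: sqrt_continuous.
apply: continuous_big; first exact: add_continuous.
move=> i _ y; have c := @coord_continuous R _ _ ord0 i y.
exact: (cvgM c c).
Qed.

(** The hypothesis is a squared 1/2-Hölder bound. No sign of [C] is assumed, which explains
    [|C| + 1] in the modulus of continuity. *)
Lemma holder_within_continuous (R : realType) (f : R -> R) (C a : R) :
  (forall s t, 0 <= s -> s <= t -> t <= a -> (f t - f s) ^+ 2 <= C * (t - s)) ->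
  {within `[0%R, a], continuous f}.
Proof.
move=> hf; apply/subspace_continuousP => x /=; rewrite in_itv/= => /andP[x0 xa].
apply/cvgrPdist_le => e e0.
have C0 : 0 < `|C| + 1 by rewrite ltr_wpDl.
have q0 : 0 < e ^+ 2 / (`|C| + 1) by rewrite divr_gt0// exprn_gt0.
rewrite near_withinE; near=> y; rewrite /= in_itv/= => /andP[y0 ya].
rewrite -ler_sqr ?nnegrE ?(ltW e0)// real_normK ?num_real//.
have xy : `|x - y| < e ^+ 2 / (`|C| + 1).
  by near: y; exact: (@cvgr_dist_lt _ _ _ (nbhs x) _ id x cvg_id _ q0).
apply: (@le_trans _ _ (`|C| * `|x - y|)).
  have CC := ler_norm C.
  case: (leP x y) => [le_xy|/ltW le_yx].
    have -> : `|x - y| = y - x by rewrite distrC ger0_norm ?subr_ge0.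
    rewrite -sqrrN opprB.
    by apply: le_trans (hf _ _ x0 le_xy ya) _; rewrite ler_wpM2r ?subr_ge0.
  have -> : `|x - y| = x - y by rewrite ger0_norm ?subr_ge0.
  by apply: le_trans (hf _ _ y0 le_yx xa) _; rewrite ler_wpM2r ?subr_ge0.
move: xy; rewrite ltr_pdivlMr// => xy.
by have := normr_ge0 (x - y); lra.
Unshelve. all: by end_near. Qed.

(** The freedom in [r] serves the two sides: [r] is the left endpoint for positive increments [h]
    and the right endpoint for negative ones. Dividing by [h^2] leaves a squared error of at most
    [|K| |h|]. *)
Lemma taylor_derive (R : realType) (d : nat) (a K t : R) (phi v : R -> 'rV[R]_d) :
  (forall s r t, 0 <= s -> s <= r -> r <= t -> t <= a ->
     enorm (phi t - phi s - (t - s) *: v r) ^+ 2 <= K * (t - s) ^+ 3) ->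
  0 < t < a -> derivable phi t 1 /\ 'D_1 phi t = v t.
Proof.
move=> hphi /andP[t0 ta].
suff c : h^-1 *: (phi (h *: (1 : R) + t) - phi t) @[h --> 0^'] --> v t.
  by split; [apply/cvg_ex; exists (v t)|exact: cvg_lim].
apply/cvgrPdist_le => e e0.
have C0 : 0 < `|K| + 1 by rewrite ltr_wpDl.
have q0 : 0 < e ^+ 2 / (`|K| + 1) by rewrite divr_gt0// exprn_gt0.
near=> h.
have hn0 : h != 0 by near: h; exact: nbhs_dnbhs_neq.
have hq : `|h| < e ^+ 2 / (`|K| + 1) by near: h; exact: dnbhs0_lt.
have ht : `|h| < t by near: h; exact: dnbhs0_lt.
have hta : `|h| < a - t by near: h; apply: dnbhs0_lt; rewrite subr_gt0.
have nh : 0 < `|h| by rewrite normr_gt0.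
apply: le_trans (norm_le_enorm _) _.
rewrite enormC enorm_le ?(ltW e0)//.
have -> : h^-1 *: (phi (h *: (1 : R) + t) - phi t) - v t =
    h^-1 *: (phi (h + t) - phi t - h *: v t).
  by rewrite [h *: (1 : R)]mulr1 !scalerBr scalerA mulVf// scale1r.
rewrite enormZ exprMn.
suff : enorm (phi (h + t) - phi t - h *: v t) ^+ 2 <= `|K| * `|h| ^+ 3.
  move=> hh; have n2 : 0 <= `|h^-1| ^+ 2 by exact: sqr_ge0.
  apply: le_trans (ler_wpM2l n2 hh) _.
  have -> : `|h^-1| ^+ 2 * (`|K| * `|h| ^+ 3) = `|K| * `|h|.
    by rewrite normfV; field; rewrite gt_eqF.
  by move: hq; rewrite ltr_pdivlMr// => xy; lra.
move: ht hta; rewrite !ltr_norml => /andP[h1 h2] /andP[h3 h4].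
have KK := ler_norm K.
have [h0|h0] := leP 0 h.
  have := hphi t t (h + t); rewrite addrK => H.
  apply: le_trans (H _ _ _ _) _; try lra.
  by rewrite (ger0_norm h0) ler_wpM2r// exprn_ge0.
have := hphi (h + t) t t; rewrite opprD addrCA subrr addr0 => H.
have -> : phi (h + t) - phi t - h *: v t = - (phi t - phi (h + t) - (- h) *: v t).
  by rewrite scaleNr opprK opprD opprB.
rewrite enormN; apply: le_trans (H _ _ _ _) _; try lra.
rewrite (ltr0_norm h0) ler_wpM2r// exprn_ge0//; lra.
Unshelve. all: by end_near. Qed.

Lemma energyS (R : realType) (d : nat) (s t s' t' : R) (k : 'I_d -> R -> R) :
  s <= s' -> t' <= t -> (forall j, sqintegrable `[s, t] (k j)) ->
  energy `[s', t'] k <= energy `[s, t] k.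
Proof.
move=> ss tt hk; apply: ler_sum => j _.
have hk' := sqintegrableS ss tt (hk j).
rewrite -lee_fin -!integral_itv_fine; [|exact: (hk j).2|exact: hk'.2].
apply: ge0_subset_integral => //.
- by apply/measurable_EFinP/measurable_funX; exact: (hk j).1.
- by move=> x _; rewrite lee_fin sqr_ge0.
- by apply: subset_itv; rewrite bnd_simp.
Qed.

Lemma energy_le_const (R : realType) (d : nat) (s t C : R) (k : 'I_d -> R -> R) :
  s <= t -> (forall j, sqintegrable `[s, t] (k j)) ->
  (forall x, s <= x <= t -> \sum_(j < d) k j x ^+ 2 <= C) ->
  energy `[s, t] k <= C * (t - s).
Proof.
move=> st hk kC; rewrite -(Rintegral_cst_itv C st).
rewrite -lee_fin /energy -sumEFin -integral_itv_fine; last exact: integrable_cst_itv.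
rewrite (eq_bigr (fun j => \int[@lebesgue_measure R]_(x in `[s, t]) (k j x ^+ 2)%:E)%E);
  last by move=> j _; rewrite integral_itv_fine//; exact: (hk j).2.
rewrite -ge0_integral_sum//.
- apply: ge0_le_integral => //.
  + by move=> x _; apply: sume_ge0 => j _; rewrite lee_fin sqr_ge0.
  + apply: emeasurable_sum => j.
    by apply/measurable_EFinP/measurable_funX; exact: (hk j).1.
  + by move=> x; rewrite /= in_itv/= => xst; rewrite sumEFin lee_fin kC.
- by move=> j; apply/measurable_EFinP/measurable_funX; exact: (hk j).1.
- by move=> j x _; rewrite lee_fin sqr_ge0.
Qed.

(** Cauchy-Schwarz in each coordinate. It yields the Hölder bound ([v] with its curvature), the
    Taylor estimate ([phi] minus a linear motion) and the Lipschitz bound ([phi] with [v]). *)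
Lemma enorm_increment (R : realType) (d : nat) (a s t : R) (u : R -> 'rV[R]_d)
  (k : 'I_d -> R -> R) : (forall j, sqintegrable `[0%R, a] (k j)) ->
  (forall t, 0 <= t <= a -> forall j,
     u t ord0 j = u 0 ord0 j + \int[@lebesgue_measure R]_(x in `[0%R, t]) k j x) ->
  0 <= s -> s <= t -> t <= a ->
  enorm (u t - u s) ^+ 2 <= (t - s) * energy `[s, t] k.
Proof.
move=> hk hu s0 st ta; rewrite sqr_enorm /energy mulr_sumr.
apply: ler_sum => j _; rewrite !mxE.
have t0 := le_trans s0 st; have sa := le_trans st ta.
rewrite (hu t) ?t0// (hu s) ?s0// opprD addrACA subrr add0r.
have hk' := sqintegrableS s0 ta (hk j).
have it := sqintegrable_integrable (sqintegrableS (lexx 0) ta (hk j)).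
rewrite Rintegral_itvB// ?bnd_simp//.
rewrite Rintegral_itv_obnd_cbnd; first exact: cauchy_schwarz_itv.
apply: integrableS (sqintegrable_integrable hk') => //.
by apply: subset_itv; rewrite bnd_simp.
Qed.

(** * Unit-speed curves with square integrable curvature *)

Lemma integral_sqr_enorm (R : realType) (d : nat) (s t : R) (kappa : R -> 'rV[R]_d) :
  (forall j, sqintegrable `[s, t] (fun x => kappa x ord0 j)) ->
  (\int[@lebesgue_measure R]_(x in `[s, t]) ((enorm (kappa x)) ^+ 2)%:E)%E =
  (energy `[s, t] (fun j x => kappa x ord0 j))%:E.
Proof.
move=> hk; rewrite /energy -sumEFin.
rewrite [RHS](eq_bigr (fun j =>
    \int[@lebesgue_measure R]_(x in `[s, t]) (kappa x ord0 j ^+ 2)%:E)%E);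
  last by move=> j _; rewrite integral_itv_fine//; exact: (hk j).2.
rewrite -ge0_integral_sum//.
- by apply: eq_integral => x _; rewrite sqr_enorm sumEFin.
- by move=> j; apply/measurable_EFinP/measurable_funX; exact: (hk j).1.
- by move=> j x _; rewrite lee_fin sqr_ge0.
Qed.

Lemma sqintegrable_coord (R : realType) (d : nat) (s t : R) (kappa : R -> 'rV[R]_d) :
  (forall j, measurable_fun `[s, t] (fun x => kappa x ord0 j)) ->
  (\int[@lebesgue_measure R]_(x in `[s, t]) ((enorm (kappa x)) ^+ 2)%:E < +oo)%E ->
  forall j, sqintegrable `[s, t] (fun x => kappa x ord0 j).
Proof.
move=> mk kfin j; split => //.
apply: (integrable_le_itv (g := fun x => enorm (kappa x) ^+ 2)).
- exact: measurable_funX.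
- move=> x _; rewrite ger0_norm ?sqr_ge0// -[X in X <= _]real_normK ?num_real//.
  by rewrite lerXn2r ?nnegrE ?enorm_ge0// coord_le_enorm.
- apply/integrableP; split.
    apply/measurable_EFinP.
    rewrite (_ : (fun x => _) = (fun x => \sum_(i < d) kappa x ord0 i ^+ 2)); last first.
      by apply/funext => x; rewrite sqr_enorm.
    by apply: measurable_sum => i; exact: (measurable_funX 2 (mk i)).
  by under eq_integral do rewrite gee0_abs ?lee_fin ?sqr_ge0//.
Qed.

(** A null set cannot contain an interval of positive length; this lets continuity upgrade unit
    speed from almost every time to every time. *)
Lemma ae_exists_itv (R : realType) (P : R -> Prop) (lo hi : R) : lo < hi ->
  {ae @lebesgue_measure R, forall x, P x} -> exists2 x, lo < x < hi & P x.
Proof.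
move=> lohi [N [mN N0 PN]]; apply: contrapT => nex.
have sub : `]lo, hi[ `<=` N.
  move=> x /=; rewrite in_itv/= => xlh; apply: PN => /= Px.
  by apply: nex; exists x.
have : (@lebesgue_measure R `]lo, hi[ <= 0)%E.
  by rewrite -N0; apply: le_measure; rewrite ?inE.
by rewrite lebesgue_measure_itv/= lte_fin lohi -EFinB lee_fin subr_le0 leNgt lohi.
Qed.

(** The single constant [K] bounds the curvature energy and serves as Hölder and Taylor constant.
    The first four conditions involve neither derivatives nor null sets, so they survive pointwise
    limits; the last one is what the minimal-norm argument consumes. *)
Definition tame (R : realType) (d : nat) (a K : R) (phi v : R -> 'rV[R]_d)
    (k : 'I_d -> R -> R) : Prop :=
  [/\ forall t, 0 <= t <= a -> enorm (v t) = 1,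
    forall s t, 0 <= s -> s <= t -> t <= a -> enorm (v t - v s) ^+ 2 <= K * (t - s),
    forall s t, 0 <= s -> s <= t -> t <= a -> enorm (phi t - phi s) <= t - s,
    forall s r t, 0 <= s -> s <= r -> r <= t -> t <= a ->
      enorm (phi t - phi s - (t - s) *: v r) ^+ 2 <= K * (t - s) ^+ 3 &
    [/\ forall j, sqintegrable `[0%R, a] (k j), energy `[0%R, a] k <= K &
      forall t, 0 <= t <= a -> forall j,
        v t ord0 j = v 0 ord0 j + \int[@lebesgue_measure R]_(x in `[0%R, t]) k j x]].

(* At [a = 0] the hypotheses say nothing about [v], hence the new [v']. *)
Lemma H2wit_tame (R : realType) (d : nat) (a K : R) (phi v kappa : R -> 'rV[R]_d) :
  (0 < d)%N -> inC a phi -> H2wit a phi v kappa ->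
  (\int[@lebesgue_measure R]_(t in `[0%R, a]) ((enorm (kappa t)) ^+ 2)%:E)%E = K%:E ->
  exists v' k, tame a K phi v' k.
Proof.
move=> d0 [a0 [_ ae1]] [mk [kfin [hv hphi]]] hK.
have K0 : 0 <= K.
  by rewrite -lee_fin -hK; apply: integral_ge0 => x _; rewrite lee_fin sqr_ge0.
have [a_eq0|an0] := eqVneq a 0.
  exists (fun=> delta_mx ord0 (Ordinal d0)), (fun _ _ => 0).
  have bnd c : 0 <= c -> c <= a -> c = 0.
    by rewrite a_eq0 => *; apply/eqP; rewrite eq_le; apply/andP.
  split.
  - by move=> t _; rewrite enorm_delta.
  - by move=> s t s0 st ta; rewrite subrr enorm0 expr0n/= mulr_ge0// subr_ge0.
  - move=> s t s0 st ta.
    by rewrite (bnd t)// ?(le_trans s0)// (bnd s)// ?(le_trans st)// !subrr enorm0.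
  - move=> s r t s0 sr rt ta.
    rewrite (bnd t)// ?(le_trans s0)// ?(le_trans sr)// (bnd s)//
      ?(le_trans sr)// ?(le_trans rt)//.
    by rewrite !subrr scale0r subr0 enorm0 !expr0n/= mulr0.
  - split.
    + by move=> j; apply: (@sqintegrable_bounded _ _ _ 0) => // x _; rewrite normr0.
    + rewrite /energy big1// => j _; rewrite expr0n/=.
      by rewrite Rintegral_cst// mul0r.
    + by move=> t _ j; rewrite Rintegral_cst// mul0r addr0.
have {an0} a0' : 0 < a by rewrite lt_def an0.
have hk := sqintegrable_coord mk kfin.
have EK : energy `[0%R, a] (fun j x => kappa x ord0 j) = K.
  by apply: EFin_inj; rewrite -hK integral_sqr_enorm.
have hol s t : 0 <= s -> s <= t -> t <= a -> enorm (v t - v s) ^+ 2 <= K * (t - s).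
  move=> s0 st ta; apply: le_trans (enorm_increment hk hv s0 st ta) _.
  by rewrite mulrC ler_wpM2r ?subr_ge0// -EK energyS.
have holj j s t : 0 <= s -> s <= t -> t <= a ->
    (v t ord0 j - v s ord0 j) ^+ 2 <= K * (t - s).
  move=> s0 st ta; apply: le_trans (hol _ _ s0 st ta).
  have := coord_le_enorm (v t - v s) j; rewrite !mxE => h.
  by rewrite -[X in X <= _]real_normK ?num_real// lerXn2r ?nnegrE ?enorm_ge0.
have mv j : measurable_fun `[0%R, a] (fun x => v x ord0 j).
  apply: subspace_continuous_measurable_fun => //.
  exact: holder_within_continuous (holj j).
have sv j : sqintegrable `[0%R, a] (fun x => v x ord0 j).
  (* A crude bound from [|y| <= 1 + y^2]: that [v] has norm 1 is only proved later, from the Taylor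
     estimate, which itself needs this integrability. *)
  apply: (@sqintegrable_bounded _ _ _ (`|v 0 ord0 j| + (1 + K * a))) => // x /=.
  rewrite in_itv/= => /andP[x0 xa].
  rewrite -[v x ord0 j](subrK (v 0 ord0 j)) addrC.
  apply: le_trans (ler_normD _ _) _; rewrite lerD2l.
  have := holj j 0 x (lexx _) x0 xa; rewrite subr0 => h.
  have {}h : (v x ord0 j - v 0 ord0 j) ^+ 2 <= K * a.
    by apply: le_trans h _; rewrite ler_wpM2l.
  apply/ler_normlP; set y := v x ord0 j - _ in h *.
  by split; have := sqr_ge0 (y - 1); have := sqr_ge0 (y + 1); lra.
have sC c : sqintegrable `[0%R, a] (fun=> c).
  by apply: (@sqintegrable_bounded _ _ _ `|c|).
have taylor s r t : 0 <= s -> s <= r -> r <= t -> t <= a ->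
      enorm (phi t - phi s - (t - s) *: v r) ^+ 2 <= K * (t - s) ^+ 3.
  move=> s0 sr rt ta; have st := le_trans sr rt.
  pose f j x := v x ord0 j - v r ord0 j.
  have hf j : sqintegrable `[0%R, a] (f j) by exact: sqintegrableB.
  (* Subtracting the linear motion leaves a function with derivative [v - v r]. Of the three factors
     [t - s], one comes from Cauchy-Schwarz, one from the length of the interval and one from the
     Hölder bound on [v]. *)
  pose u x := phi x - x *: v r.
  have hu x : 0 <= x <= a -> forall j,
     u x ord0 j = u 0 ord0 j + \int[@lebesgue_measure R]_(y in `[0%R, x]) f j y.
    move=> /andP[x0 xa] j; rewrite !mxE hphi ?x0// mul0r subr0.
    rewrite RintegralB//; [|exact/sqintegrable_integrable/(sqintegrableS _ xa (sv j))|
      exact: integrable_cst_itv].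
    by rewrite Rintegral_cst_itv// subr0 addrA (mulrC x).
  have := enorm_increment hf hu s0 st ta.
  have -> : u t - u s = phi t - phi s - (t - s) *: v r.
    by rewrite /u scalerBl !opprD !opprK !addrA; congr (_ + _); rewrite addrAC.
  move=> h; apply: le_trans h _.
  have -> : K * (t - s) ^+ 3 = (t - s) * (K * (t - s) * (t - s)) by ring.
  rewrite ler_wpM2l ?subr_ge0//; apply: energy_le_const => //.
    by move=> j; apply: sqintegrableS (hf j).
  move=> x /andP[sx xt].
  have -> : \sum_(j < d) f j x ^+ 2 = enorm (v x - v r) ^+ 2.
    by rewrite sqr_enorm; apply: eq_bigr => j _; rewrite !mxE.
  have [rx|/ltW xr] := leP r x.
    apply: le_trans (hol _ _ (le_trans s0 sr) rx (le_trans xt ta)) _.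
    by rewrite ler_wpM2l// lerB.
  rewrite enormC; apply: le_trans (hol _ _ (le_trans s0 sx) xr (le_trans rt ta)) _.
  by rewrite ler_wpM2l// lerB.
(* If the norm of [v t] differed from 1 by [e], then by the Hölder bound no time within [dl] of [t]
   would have unit speed, against the almost everywhere hypothesis. Taking max and min with 0 and
   [a] keeps the interval inside even when [t] is an endpoint. *)
have v1 t : 0 <= t <= a -> enorm (v t) = 1.
  move=> /andP[t0 ta]; apply/eqP; apply: contrapT => /negP v1.
  pose e := `|enorm (v t) - 1|.
  have e0 : 0 < e by rewrite normr_gt0 subr_eq0.
  pose dl := e ^+ 2 / (K + 1).
  have K1 : 0 < K + 1 by rewrite ltr_wpDl.
  have dl0 : 0 < dl by rewrite divr_gt0// exprn_gt0.
  have lohi : Num.max 0 (t - dl) < Num.min a (t + dl).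
    by rewrite gt_max !lt_min; apply/andP; split; apply/andP; split; lra.
  have [x] := ae_exists_itv lohi ae1.
  rewrite gt_max lt_min => /andP[/andP[x0 tx] /andP[xa xt]] hx.
  have [_] := hx (introT andP (conj x0 xa)).
  have [|_ ->] := @taylor_derive _ _ a K x phi v taylor; first by rewrite x0.
  move=> vx1.
  have : enorm (v t - v x) ^+ 2 < e ^+ 2.
    have KD : K * dl < e ^+ 2.
      rewrite /dl mulrA ltr_pdivrMr// mulrC.
      by have e2 : 0 < e ^+ 2; [rewrite exprn_gt0|lra].
    have [lxt|/ltW ltx] := leP x t.
      apply: le_lt_trans (hol _ _ (ltW x0) lxt ta) _; apply: le_lt_trans KD.
      by rewrite ler_wpM2l//; move: tx; lra.
    rewrite enormC; apply: le_lt_trans (hol _ _ t0 ltx (ltW xa)) _.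
    by apply: le_lt_trans KD; rewrite ler_wpM2l//; lra.
  rewrite ltNge => /negP; apply.
  rewrite lerXn2r ?nnegrE ?enorm_ge0 ?(ltW e0)//.
  by rewrite /e -vx1 enorm_dist.
exists v, (fun j x => kappa x ord0 j); split => //.
- move=> s t s0 st ta.
  rewrite enorm_le ?subr_ge0//.
  apply: le_trans (enorm_increment sv hphi s0 st ta) _.
  rewrite expr2 ler_wpM2l ?subr_ge0// -[leRHS]mul1r.
  apply: energy_le_const => //; first by move=> j; apply: sqintegrableS (sv j).
  move=> x /andP[sx xt]; rewrite -sqr_enorm v1 ?expr1n//.
  by rewrite (le_trans s0)// (le_trans xt).
- by split => //; rewrite EK.
Qed.

(** * Limits along an ultrafilter *)

(** The image of an ultrafilter is an ultrafilter, since [U] contains the preimage of a set or of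
    its complement; compactness makes it converge. *)
Lemma ultra_cvg_compact (T : topologicalType) (U : set_system nat) (u : nat -> T)
  (C : set T) : UltraFilter U -> compact C -> (forall n, C (u n)) ->
  exists l : T, u n @[n --> U] --> l.
Proof.
move=> UU; rewrite compact_ultra => cC Cu.
have UF : UltraFilter (fmap u U).
  split; first exact: fmap_proper_filter.
  move=> G PG UG; apply/seteqP; split=> [A GA|A UA]; last exact: UG.
  have [//|nA] := @in_ultra_setVsetC _ U (u @^-1` A) UU.
  have GnA : G (~` A) by apply: UG.
  by have := filter_ex (filterI GA GnA) => -[x []].
have [l [_ ul]] := cC _ UF (@filterE _ U _ _ Cu).
by exists l.
Qed.

Lemma ultra_cvg_real (R : realType) (U : set_system nat) (u : nat -> R) (M : R) :
  UltraFilter U -> (forall n, 0 <= u n <= M) -> exists l : R, u n @[n --> U] --> l.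
Proof.
move=> UU uM; apply: (ultra_cvg_compact UU (@segment_compact R 0 M)) => n.
by rewrite /= in_itv/=; exact: uM.
Qed.

Lemma ultra_cvg_row (R : realType) (d : nat) (U : set_system nat)
  (u : nat -> 'rV[R]_d) (M : R) :
  UltraFilter U -> (forall n, enorm (u n) <= M) ->
  exists l : 'rV[R]_d, u n @[n --> U] --> l.
Proof.
move=> UU uM.
have C : compact [set x : 'rV[R]_d | forall i, `[- M, M]%classic (x ord0 i)].
  by apply: (@rV_compact R d (fun=> `[- M, M]%classic)) => _; exact: segment_compact.
apply: (ultra_cvg_compact UU C) => n i; rewrite /= in_itv/= -ler_norml.
exact: le_trans (coord_le_enorm _ _) (uM n).
Qed.

Lemma cvg_enorm (R : realType) (d : nat) (U : set_system nat) (u : nat -> 'rV[R]_d) l :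
  Filter U -> u n @[n --> U] --> l -> enorm (u n) @[n --> U] --> enorm l.
Proof. by move=> FU ul; exact: (cvg_comp _ _ ul (@continuous_enorm R d l)). Qed.

Lemma cvg_enorm2 (R : realType) (d : nat) (U : set_system nat) (u : nat -> 'rV[R]_d) l :
  Filter U -> u n @[n --> U] --> l -> enorm (u n) ^+ 2 @[n --> U] --> enorm l ^+ 2.
Proof. by move=> FU /(cvg_enorm FU) c; exact: (cvgM c c). Qed.

(* Equicontinuity reduces uniform convergence to convergence on a finite net. *)
Lemma holder_cvg_uniform (R : realType) (d : nat) (U : set_system nat)
  (f : nat -> R -> 'rV[R]_d) (g : R -> 'rV[R]_d) (a C : R) :
  ProperFilter U -> 0 <= C ->
  (\forall n \near U, forall s t, 0 <= s -> s <= t -> t <= a ->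
     enorm (f n t - f n s) ^+ 2 <= C * (t - s)) ->
  (forall t, 0 <= t <= a -> f n t @[n --> U] --> g t) ->
  forall e, 0 < e -> \forall n \near U, forall t, 0 <= t <= a ->
    enorm (f n t - g t) <= e.
Proof.
move=> PU C0 hf fg e e0; have FU : Filter U by exact: _.
have hg s t : 0 <= s -> s <= t -> t <= a -> enorm (g t - g s) ^+ 2 <= C * (t - s).
  move=> s0 st ta.
  have c : (f n t - f n s) @[n --> U] --> g t - g s.
    by apply: cvgB; apply: fg; apply/andP; split => //; lra.
  have c2 : C * (t - s) @[_ --> U] --> C * (t - s) by exact: cvg_cst.
  apply: (ler_cvg_to (cvg_enorm2 FU c) c2).
  by apply: filterS hf => n; exact.
(* Chosen so that moving to the net point just below [t] costs at most [e / 3], once for [f n] and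
   once for [g]; the last third is the error on the net. *)
pose dl := (e / 3) ^+ 2 / (C + 1).
have C1 : 0 < C + 1 by rewrite ltr_wpDl.
have dl0 : 0 < dl by rewrite divr_gt0// exprn_gt0// divr_gt0.
have Cdl : C * dl <= (e / 3) ^+ 2.
  rewrite /dl mulrA ler_pdivrMr// mulrC.
  by have e2 : 0 < (e / 3) ^+ 2; [rewrite exprn_gt0// divr_gt0|lra].
have [a0|a0] := ltP a 0.
  by apply: nearW => n t /andP[t0 ta]; have := le_trans t0 ta; rewrite leNgt a0.
pose N := Num.truncn (a / dl).
have net : \forall n \near U, forall i : 'I_N.+1,
    enorm (f n (i%:R * dl) - g (i%:R * dl)) <= e / 3.
  apply: filter_forall => i.
  have ia : 0 <= (i : nat)%:R * dl <= a.
    rewrite mulr_ge0 ?ler0n ?(ltW dl0)//=.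
    rewrite -ler_pdivlMr//; have := ltn_ord i; rewrite ltnS => iN.
    apply: (@le_trans _ _ N%:R); first by rewrite ler_nat.
    by rewrite truncn_le// divr_ge0// ltW.
  have c : (f n (i%:R * dl) - g (i%:R * dl)) @[n --> U] --> g (i%:R * dl) - g (i%:R * dl).
    by apply: cvgB; [exact: fg|exact: cvg_cst].
  have := cvg_enorm FU c; rewrite subrr enorm0 => /cvgrPdist_le/(_ (e / 3)).
  have e3 : 0 < e / 3 by rewrite divr_gt0.
  move=> /(_ e3); apply: filterS => n.
  by rewrite sub0r normrN ger0_norm// enorm_ge0.
apply: filterS2 hf net => n hfn netn t /andP[t0 ta].
have tdl : 0 <= t / dl by rewrite divr_ge0// ltW.
have iN : (Num.truncn (t / dl) < N.+1)%N.
  by rewrite ltnS /N le_truncn// ler_wpM2r// invr_ge0 ltW.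
have := netn (Ordinal iN); rewrite /=; set x := _ * dl => nx.
have [xt tx] : x <= t /\ t - x <= dl.
  have /andP[t1 t2] := truncn_itv tdl.
  split; first by rewrite -ler_pdivlMr.
  move: t2; rewrite ltr_pdivrMr// -addn1 natrD mulrDl mul1r => t2.
  by rewrite lerBlDl ltW.
have x0 : 0 <= x by rewrite mulr_ge0 ?ler0n ?(ltW dl0).
have small (h : R -> 'rV[R]_d) : (forall s t, 0 <= s -> s <= t -> t <= a ->
    enorm (h t - h s) ^+ 2 <= C * (t - s)) -> enorm (h t - h x) <= e / 3.
  move=> hh; rewrite enorm_le ?divr_ge0 ?(ltW e0)//.
  apply: le_trans (hh _ _ x0 xt ta) _; apply: le_trans Cdl.
  by rewrite ler_wpM2l.
have s1 := small _ hfn; have s2 := small _ hg.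
have t1 := enorm_triangle (f n t) (f n x) (g t).
have t2 := enorm_triangle (f n x) (g x) (g t).
by move: s2 t1 t2; rewrite (enormC (g t)) => s2 t1 t2; lra.
Qed.

(** * Curves of different lengths on a common time axis *)

Ltac case_ifs := repeat match goal with
  |- context [if ?x < ?y then _ else _] => case: (ltP x y) => ? end.

Definition clamp (R : realType) (a t : R) : R := Num.max 0 (Num.min t a).

Lemma clamp_itv (R : realType) (a t : R) : 0 <= a -> 0 <= clamp a t <= a.
Proof. by move=> a0; rewrite /clamp le_max lexx ge_max a0 ge_min lexx orbT. Qed.

Lemma clamp_id (R : realType) (a t : R) : 0 <= t <= a -> clamp a t = t.
Proof. by move=> /andP[t0 ta]; rewrite /clamp min_l// max_r. Qed.

Lemma clamp_le (R : realType) (a s t : R) : s <= t -> clamp a s <= clamp a t.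
Proof.
move=> st; rewrite /clamp /Num.max /Num.min.
by case: (ltP t a) => ?; case: (ltP s a) => ?; case_ifs; lra.
Qed.

Lemma clamp_lip (R : realType) (a s t : R) : s <= t -> clamp a t - clamp a s <= t - s.
Proof.
move=> st; rewrite /clamp /Num.max /Num.min.
by case: (ltP t a) => ?; case: (ltP s a) => ?; case_ifs; lra.
Qed.

(** Lipschitz dependence on the endpoint turns convergence of the lengths into convergence of the
    clamped times, and later bounds the piece of curve cut off beyond [a]. *)
Lemma clamp_dist (R : realType) (a b t : R) : `|clamp a t - clamp b t| <= `|a - b|.
Proof.
rewrite ler_norml /clamp /Num.max /Num.min.
have n1 := ler_norm (a - b); have := ler_norm (b - a); rewrite distrC => n2.
have n0 := normr_ge0 (a - b).
by apply/andP; case: (ltP t a) => ?; case: (ltP t b) => ?;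
  case_ifs; split; lra.
Qed.

Lemma cvg_clamp (R : realType) (U : set_system nat) (A : nat -> R) (a t : R) :
  Filter U -> A n @[n --> U] --> a -> clamp (A n) t @[n --> U] --> clamp a t.
Proof.
move=> FU /cvgrPdist_lt Aa; apply/cvgrPdist_lt => e e0.
by apply: filterS (Aa _ e0) => n; apply: le_lt_trans; exact: clamp_dist.
Qed.

(** Extension by zero carries a curvature on [[0, A n]] to the limit interval, whichever of the two
    is longer. *)
Lemma sqintegrable_patch (R : realType) (a b : R) (f : R -> R) :
  sqintegrable `[0%R, a] f -> sqintegrable `[0%R, b] (f \_ `[0%R, a]).
Proof.
move=> [mf f2].
have mf' : measurable_fun `[0%R, b] (f \_ `[0%R, a]).
  apply/measurable_restrict => //.
  by apply: measurable_funS mf => //; exact: subIsetl.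
split=> //; have -> : (EFin \o (fun t => (f \_ `[0%R, a]) t ^+ 2)) =
   (EFin \o (fun t => f t ^+ 2)) \_ `[0%R, a].
  by apply/funext => x /=; rewrite /patch; case: ifP; rewrite ?expr0n.
apply/integrable_restrict => //.
by apply: integrableS f2 => //; exact: measurableI.
Qed.

Lemma Rintegral_patch (R : realType) (a t : R) (f : R -> R) :
  \int[@lebesgue_measure R]_(x in `[0%R, t]) (f \_ `[0%R, a]) x =
  \int[@lebesgue_measure R]_(x in `[0%R, Num.min t a]) f x.
Proof.
rewrite -Rintegral_mkcondr; congr Rintegral.
apply/seteqP; split => x /=; rewrite !in_itv/= le_min.
- by move=> [/andP[-> ->] /andP[_ ->]].
- by move=> /andP[-> /andP[-> ->]].
Qed.

(** Turns the derivative obtained from the Taylor estimate back into the integral form that [H2wit]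
    demands. *)
Lemma C1_primitive (R : realType) (F f : R -> R) (a : R) : 0 <= a ->
  {within `[0%R, a], continuous F} -> {within `[0%R, a], continuous f} ->
  (forall t, 0 < t < a -> derivable F t 1 /\ 'D_1 F t = f t) ->
  forall t, 0 <= t <= a ->
    F t = F 0 + \int[@lebesgue_measure R]_(x in `[0%R, t]) f x.
Proof.
move=> a0 cF cf dF t /andP[t0 ta].
move: t0; rewrite le_eqVlt => /predU1P[<-|t0].
  by rewrite set_itv1 Rintegral_set1 addr0.
have sub : `[0%R, t] `<=` `[0%R, a] by apply: subset_itvl; rewrite bnd_simp.
have cF' := continuous_subspaceW sub cF; have cf' := continuous_subspaceW sub cf.
have [_ cF0 cFt] := (continuous_within_itvP F t0).1 cF'.
have tin x : x \in `]0, t[ -> 0 < x < a.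
  by rewrite in_itv/= => /andP[x0 xt]; rewrite x0 (lt_le_trans xt).
rewrite /Rintegral (@continuous_FTC2 _ f F 0 t)//.
- by rewrite -EFinB/= addrC subrK.
- by split => // x /tin/dF[].
- by move=> x /tin/dF[_ <-]; rewrite derive1E.
Qed.

(** Compactness and lower semicontinuity in one statement. The closeness of images is one-sided,
    which is the direction [fidelity_le] asks for. *)
Lemma tame_limit (R : realType) (d : nat) (U : set_system nat) (A Kn : nat -> R)
  (phi v : nat -> R -> 'rV[R]_d) (k : nat -> 'I_d -> R -> R) (a K B M : R) :
  UltraFilter U -> (forall n, 0 <= A n <= M) ->
  (forall n, tame (A n) (Kn n) (phi n) (v n) (k n)) ->
  (forall n, enorm (phi n 0) <= B) ->
  A n @[n --> U] --> a -> Kn n @[n --> U] --> K ->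
  exists Phi : R -> 'rV[R]_d, [/\ inC a Phi, inH2 a Phi,
    (curv_energy a Phi <= K%:E)%E &
    forall e, 0 < e -> \forall n \near U, forall t, 0 <= t <= A n ->
      exists2 s, 0 <= s <= a & enorm (phi n t - Phi s) <= e].
Proof.
move=> UU AM tm phiB Aa KnK.
have PU : ProperFilter U by exact: ultra_proper.
have FU : Filter U by exact: _.
have A0 n : 0 <= A n by have /andP[] := AM n.
have cl0 n t : 0 <= clamp (A n) t by have /andP[] := clamp_itv t (A0 n).
have clA n t : clamp (A n) t <= A n by have /andP[] := clamp_itv t (A0 n).
pose V n t := v n (clamp (A n) t); pose P n t := phi n (clamp (A n) t).
have Kn0 n : 0 <= Kn n.
  by have [_ _ _ _ [_ eK _]] := tm n; apply: le_trans eK; exact: energy_ge0.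
have cstU (c : R) : c @[_ --> U] --> c by exact: cvg_cst.
have a0 : 0 <= a by apply: (ler_cvg_to (cstU 0) Aa); exact: nearW.
have K0 : 0 <= K by apply: (ler_cvg_to (cstU 0) KnK); exact: nearW.
have V1 n t : enorm (V n t) = 1.
  by have [h _ _ _ _] := tm n; rewrite h// cl0 clA.
have lipP n s t : s <= t -> enorm (P n t - P n s) <= t - s.
  move=> st; have [_ _ h _ _] := tm n.
  by apply: le_trans (clamp_lip (A n) st); apply: h => //; exact: clamp_le.
have holV n s t : s <= t -> enorm (V n t - V n s) ^+ 2 <= Kn n * (t - s).
  move=> st; have [_ h _ _ _] := tm n.
  apply: le_trans (h _ _ (cl0 n s) (clamp_le _ st) (clA n t)) _.
  by rewrite ler_wpM2l// clamp_lip.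
(* A clamped curve stands still outside [[0, A n]], so the linear term must use the elapsed clamped
   time; it tends to [t - s] when both times lie in [[0, a]]. *)
have tayP n s r t : s <= r -> r <= t ->
    enorm (P n t - P n s - (clamp (A n) t - clamp (A n) s) *: V n r) ^+ 2 <=
    Kn n * (t - s) ^+ 3.
  move=> sr rt; have st := le_trans sr rt; have [_ _ _ h _] := tm n.
  apply: le_trans (h _ _ _ (cl0 n s) (clamp_le _ sr) (clamp_le _ rt) (clA n t)) _.
  rewrite ler_wpM2l// lerXn2r ?nnegrE ?subr_ge0 ?clamp_le//.
  exact: clamp_lip.
have /choice[Vl VlP] t : exists l : 'rV[R]_d, V n t @[n --> U] --> l.
  by apply: (@ultra_cvg_row _ _ _ _ 1 UU) => n; rewrite V1.
have /choice[Pl PlP] t : exists l : 'rV[R]_d, P n t @[n --> U] --> l.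
  apply: (@ultra_cvg_row _ _ _ _ (B + M) UU) => n.
  have := enorm_triangle (P n t) (phi n 0) 0; rewrite !subr0 => h.
  apply: le_trans h _; rewrite addrC lerD//.
  have [_ _ h _ _] := tm n.
  apply: le_trans (h _ _ (lexx 0) (cl0 n t) (clA n t)) _.
  by rewrite subr0; have /andP[_] := AM n; exact: le_trans (clA n t).
have holVl s t : s <= t -> enorm (Vl t - Vl s) ^+ 2 <= K * (t - s).
  move=> st; have c : (V n t - V n s) @[n --> U] --> Vl t - Vl s by exact: cvgB.
  have c2 : (Kn n * (t - s)) @[n --> U] --> K * (t - s) by exact: cvgMl.
  by apply: (ler_cvg_to (cvg_enorm2 FU c) c2); apply: nearW => n; exact: holV.
have lipPl s t : s <= t -> enorm (Pl t - Pl s) <= t - s.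
  move=> st; have c : (P n t - P n s) @[n --> U] --> Pl t - Pl s by exact: cvgB.
  by apply: (ler_cvg_to (cvg_enorm FU c) (cstU (t - s))); apply: nearW => n; exact: lipP.
have tayPl s r t : 0 <= s -> s <= r -> r <= t -> t <= a ->
    enorm (Pl t - Pl s - (t - s) *: Vl r) ^+ 2 <= K * (t - s) ^+ 3.
  move=> s0 sr rt ta.
  have clt : clamp (A n) t @[n --> U] --> t.
    rewrite -[X in _ --> X](@clamp_id _ a t); first exact: cvg_clamp.
    by apply/andP; split => //; lra.
  have cls : clamp (A n) s @[n --> U] --> s.
    rewrite -[X in _ --> X](@clamp_id _ a s); first exact: cvg_clamp.
    by apply/andP; split => //; lra.
  have c : (P n t - P n s - (clamp (A n) t - clamp (A n) s) *: V n r) @[n --> U] -->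
      Pl t - Pl s - (t - s) *: Vl r.
    apply: cvgB; first exact: cvgB.
    by apply: cvgZ => //; exact: cvgB.
  have c2 : (Kn n * (t - s) ^+ 3) @[n --> U] --> K * (t - s) ^+ 3 by exact: cvgMl.
  by apply: (ler_cvg_to (cvg_enorm2 FU c) c2); apply: nearW => n; exact: tayP.
have Vl1 t : enorm (Vl t) = 1.
  apply: (@cvg_unique _ (@Rhausdorff R) (enorm (V n t) @[n --> U])).
    exact: cvg_enorm.
  have -> : (fun n => enorm (V n t)) = (fun=> 1) by apply/funext => n; rewrite V1.
  exact: cstU.
have KnK1 e : 0 < e -> \forall n \near U, Kn n <= K + e.
  move=> e0; move/cvgrPdist_lt : KnK => /(_ e e0); apply: filterS => n.
  by rewrite ltr_norml => /andP[? _]; lra.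
(* The Hölder constants [Kn n] are at most [K + 1] only for [U]-most [n], hence the eventual
   hypothesis of the uniform convergence lemma. *)
have unifV := @holder_cvg_uniform _ _ U V Vl a (K + 1) PU (addr_ge0 K0 ler01).
have {}unifV : forall e, 0 < e -> \forall n \near U, forall t, 0 <= t <= a ->
    enorm (V n t - Vl t) <= e.
  apply: unifV; last by move=> t _; exact: VlP.
  apply: filterS (KnK1 1 ltr01) => n KK s t _ st _.
  by apply: le_trans (holV n s t st) _; rewrite ler_wpM2r// subr_ge0.
have unifP : forall e, 0 < e -> \forall n \near U, forall t, 0 <= t <= a ->
    enorm (P n t - Pl t) <= e.
  (* On [[0, a]] the Lipschitz bound is a Hölder bound with constant [a], as
     [(t - s)^2 <= a (t - s)]. *)
  apply: (@holder_cvg_uniform _ _ U P Pl a a PU a0); last by move=> t _; exact: PlP.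
  apply: nearW => n s t s0 st ta.
  have ts0 : 0 <= t - s by rewrite subr_ge0.
  have h : enorm (P n t - P n s) ^+ 2 <= (t - s) ^+ 2.
    by rewrite lerXn2r ?nnegrE ?enorm_ge0// lipP.
  by apply: le_trans h _; rewrite expr2 ler_wpM2r//; lra.
have [kap [skap ekap Pkap]] : exists kap : 'I_d -> R -> R,
    [/\ forall j, sqintegrable `[0%R, a] (kap j), energy `[0%R, a] kap <= K &
    forall j t, 0 <= t <= a ->
      \int[@lebesgue_measure R]_(x in `[0%R, t]) kap j x =
      Vl t ord0 j - Vl 0 ord0 j].
  apply: (@exists_primitive_energy_le _ _ _ _
    (fun j t => Vl t ord0 j - Vl 0 ord0 j)) => // e e0.
  (* Half of [e] for the error of the tangent at [t] and half for its error at 0. The approximate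
     primitive is the curvature of one far member of the sequence, extended by zero. *)
  have e20 : 0 < e / 2 by rewrite divr_gt0.
  have [n [nV nK]] := filter_ex (filterI (unifV _ e20) (KnK1 _ e0)).
  have [_ _ _ _ [sk ek hk]] := tm n.
  exists (fun j => k n j \_ `[0%R, A n]); split.
    split=> [j|j t /andP[t0 ta]]; first exact: sqintegrable_patch.
    rewrite Rintegral_patch.
    have ct : Num.min t (A n) = clamp (A n) t.
      by rewrite /clamp max_r// le_min t0 A0.
    have := hk (Num.min t (A n)); rewrite ct cl0 clA => /(_ isT j) hkj.
    have -> : \int[@lebesgue_measure R]_(x in `[0%R, clamp (A n) t]) k n j x =
        V n t ord0 j - V n 0 ord0 j.
      rewrite /V hkj (@clamp_id _ _ 0) ?lexx ?A0//.
      by rewrite addrC addKr.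
    have h1 := le_trans (coord_le_enorm _ j) (nV t (introT andP (conj t0 ta))).
    have h2 := le_trans (coord_le_enorm _ j) (nV 0 (introT andP (conj (lexx 0) a0))).
    move: h1 h2; rewrite !mxE !ler_norml => /andP[? ?] /andP[? ?].
    by apply/andP; split; lra.
  apply: le_trans nK; apply: le_trans ek.
  rewrite /energy; apply: ler_sum => j _.
  under eq_Rintegral => x _.
    rewrite (_ : _ ^+ 2 = ((fun x => k n j x ^+ 2) \_ `[0%R, A n]) x); last first.
      by rewrite /patch; case: ifP; rewrite ?expr0n.
    over.
  rewrite Rintegral_patch.
  (* Monotonicity for a single coordinate is the energy statement in dimension 1. *)
  have := @energyS _ 1 0 (A n) 0 (Num.min a (A n)) (fun _ => k n j) (lexx _).
  by rewrite /energy !big_ord1; apply => //; rewrite ge_min lexx orbT.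
pose kappa t : 'rV[R]_d := \row_j kap j t.
have kapE j : (fun t => kappa t ord0 j) = kap j by apply/funext => t; rewrite mxE.
have Ekap : (\int[@lebesgue_measure R]_(x in `[0%R, a]) ((enorm (kappa x)) ^+ 2)%:E <= K%:E)%E.
  rewrite integral_sqr_enorm => [|j]; last by rewrite kapE.
  by rewrite lee_fin /energy; under eq_bigr do under eq_Rintegral do rewrite mxE.
have dPl t : 0 < t < a -> derivable Pl t 1 /\ 'D_1 Pl t = Vl t.
  exact: (@taylor_derive _ _ a K t Pl Vl tayPl).
have cV j : {within `[0%R, a], continuous (fun t => Vl t ord0 j)}.
  apply: (@holder_within_continuous _ _ K) => s t s0 st ta.
  apply: le_trans (holVl s t st).
  have := coord_le_enorm (Vl t - Vl s) j; rewrite !mxE => h.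
  by rewrite -[X in X <= _]real_normK ?num_real// lerXn2r ?nnegrE ?enorm_ge0.
have cP j : {within `[0%R, a], continuous (fun t => Pl t ord0 j)}.
  apply: (@holder_within_continuous _ _ a) => s t s0 st ta.
  have := coord_le_enorm (Pl t - Pl s) j; rewrite !mxE => h.
  have h2 := le_trans h (lipPl s t st).
  rewrite -[X in X <= _]real_normK ?num_real//.
  by have n0 := normr_ge0 (Pl t ord0 j - Pl s ord0 j); nra.
have wit : H2wit a Pl Vl kappa.
  split; first by move=> j; rewrite kapE; exact: (skap j).1.
  split; first by apply: le_lt_trans Ekap _; exact: ltry.
  split=> t t0a j.
    by rewrite kapE Pkap// addrC subrK.
  apply: (@C1_primitive _ (fun t => Pl t ord0 j) (fun t => Vl t ord0 j) a) => // x /dPl[dx Dx].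
  split; first exact: ((derivable_mxP _ _ _).1 dx ord0 j).
  by rewrite -Dx derive_mx// mxE.
exists Pl; split.
- split => //; split.
    exists 1 => s t _ _; rewrite mul1r.
    have [st|/ltW ts] := leP s t.
      rewrite enormC distrC ger0_norm ?subr_ge0//; exact: lipPl.
    by rewrite ger0_norm ?subr_ge0//; exact: lipPl.
  by apply: aeW => t /dPl[dt Dt]; split => //; rewrite Dt.
- by exists Vl, kappa.
- by apply: le_trans Ekap; apply: ereal_inf_lbound; exists kappa => //; exists Vl.
- move=> e e0; have e20 : 0 < e / 2 by rewrite divr_gt0.
  move/cvgrPdist_le : Aa => /(_ _ e20) Aa.
  apply: filterS2 Aa (unifP _ e20) => n nA nP t t0A; have /andP[t0 tA] := t0A.
  (* Times beyond [a] are sent to [a]: half of [e] pays for the excess length, half for the uniform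
     distance. *)
  exists (clamp a t); first exact: clamp_itv.
  have h := nP (clamp a t) (clamp_itv t a0).
  have tr := enorm_triangle (phi n t) (P n (clamp a t)) (Pl (clamp a t)).
  apply: le_trans tr _; rewrite (splitr e) lerD//.
  have -> : phi n t = P n t by rewrite /P clamp_id.
  have ca : clamp a t <= t by rewrite /clamp ge_max t0 ge_min lexx.
  apply: le_trans (lipP _ _ _ ca) _; apply: le_trans nA.
  have := clamp_dist (A n) a t; rewrite (clamp_id t0A) distrC => hc.
  by rewrite distrC in hc; rewrite distrC; apply: le_trans hc; exact: ler_norm.
Qed.

(** * The fidelity term *)

Section Distance.
Context {R : realType} {d : nat}.
Implicit Types (x y : 'rV[R]_d) (G : set 'rV[R]_d).

Lemma distS_le x y G : G y -> distS x G <= enorm (x - y).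
Proof.
move=> Gy; apply: ge_inf; last by exists y.
by exists 0 => _ [z _ <-]; exact: enorm_ge0.
Qed.

Lemma le_distS x G r : G !=set0 -> (forall y, G y -> r <= enorm (x - y)) ->
  r <= distS x G.
Proof.
move=> [y Gy] h; apply: lb_le_inf; first by exists (enorm (x - y)), y.
by move=> _ [z Gz <-]; exact: h.
Qed.

Lemma distS_ge0 x G : G !=set0 -> 0 <= distS x G.
Proof. by move=> G0; apply: le_distS => // y _; exact: enorm_ge0. Qed.

Lemma distS_near x G G' e : G' !=set0 ->
  (forall y, G' y -> exists2 z, G z & enorm (y - z) <= e) ->
  distS x G <= distS x G' + e.
Proof.
move=> G'0 h; rewrite -lerBlDr; apply: le_distS => // y /h[z Gz yz].
rewrite lerBlDr; apply: le_trans (distS_le x Gz) _.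
by apply: le_trans (enorm_triangle x y z) _; rewrite lerD2l.
Qed.

Lemma distS_lip x y G : G !=set0 -> distS x G <= distS y G + enorm (x - y).
Proof.
move=> G0; rewrite -lerBlDr; apply: le_distS => // z Gz.
rewrite lerBlDr addrC; apply: le_trans (distS_le x Gz) _.
exact: enorm_triangle.
Qed.

Lemma continuous_distS G : G !=set0 -> continuous (fun x => distS x G).
Proof.
move=> G0 x; have FF : Filter (nbhs x) := nbhs_filter x.
apply/(@cvgrPdist_le _ _ _ (nbhs x) FF) => e e0.
have c : enorm (x - y) @[y --> x] --> (0 : R).
  rewrite -(@enorm0 R d) -(subrr x).
  apply: (cvg_comp (fun y => x - y) (@enorm R d)); last exact: continuous_enorm.
  by apply: cvgB; [exact: cvg_cst|exact: cvg_id].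
have := (@cvgrPdist_le _ _ _ (nbhs x) FF _ _).1 c e e0; apply: filterS => y.
rewrite sub0r normrN ger0_norm ?enorm_ge0// => xy.
have h1 := distS_lip x y G0; have h2 := distS_lip y x G0.
by rewrite enormC in h2; rewrite ler_norml; apply/andP; split; lra.
Qed.

Lemma measurable_fun_continuous_Borel (f : 'rV[R]_d -> R) :
  continuous f -> measurable_fun setT (f : BorelE R d -> R).
Proof.
move=> cf; apply: (measurability _ (RGenOInfty.measurableE R)).
move=> _ [_ [z ->] <-]; apply: sub_sigma_algebra; rewrite setTI.
by move/continuousP : cf; apply; exact: rray_open.
Qed.

(** Covers the truncated integrands and, with [e = 0], the fidelity integrand itself, since
    distances are nonnegative. *)
Lemma measurable_distS_powR G p e : G !=set0 ->
  measurable_fun setT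
    ((fun x => (Num.max 0 (distS (x : 'rV[R]_d) G - e) `^ p)%:E) : BorelE R d -> \bar R).
Proof.
move=> G0; apply/measurable_EFinP.
apply: (measurableT_comp (measurable_powR p)).
apply: measurable_maxr => //; apply: measurable_funB => //.
exact: (measurable_fun_continuous_Borel (continuous_distS G0)).
Qed.

End Distance.

Lemma continuous_powR_base (R : realType) (p x : R) :
  0 < x -> {for x, continuous (fun y => y `^ p)}.
Proof.
move=> x0; have [dx _] := is_derive1_powR p x0.
by apply: differentiable_continuous; exact/derivable1_diffP.
Qed.

(* [d(x, Gamma)] is recovered as the increasing limit of the truncations
   [max 0 (d(x, Gamma) - e)], each dominated by [d(x, Gamma_n)] for good [n]. *)
Lemma fidelity_le (R : realType) (d : nat)
  (mu : {measure set (BorelE R d) -> \bar R}) (p D : R) (G : set 'rV[R]_d) :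
  0 < p -> G !=set0 ->
  (forall e, 0 < e -> exists G', [/\ G' !=set0,
     forall y, G' y -> exists2 z, G z & enorm (y - z) <= e &
     (\int[mu]_(x in [set: BorelE R d]) ((distS (x : 'rV[R]_d) G') `^ p)%:E
        <= (D + e)%:E)%E]) ->
  (\int[mu]_(x in [set: BorelE R d]) ((distS (x : 'rV[R]_d) G) `^ p)%:E <= D%:E)%E.
Proof.
move=> p0 G0 hG.
pose z n : R := n.+1%:R^-1.
have z0 n : 0 < z n by rewrite invr_gt0.
have zc : z n @[n --> \oo] --> (0 : R) by exact: cvg_harmonic.
pose g n (x : BorelE R d) := (Num.max 0 (distS (x : 'rV[R]_d) G - z n) `^ p)%:E.
have gint n : (\int[mu]_(x in [set: BorelE R d]) g n x <= (D + z n)%:E)%E.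
  have [G' [G'0 GG' hD]] := hG _ (z0 n).
  apply: le_trans hD; apply: ge0_le_integral => //.
  - by move=> x _; rewrite lee_fin powR_ge0.
  - exact: measurable_distS_powR.
  - have := @measurable_distS_powR R d G' p 0 G'0.
    by apply: eq_measurable_fun => x _; rewrite subr0 max_r// distS_ge0.
  - move=> x _; rewrite lee_fin ge0_ler_powR ?nnegrE ?(ltW p0)//.
    + by rewrite le_max lexx.
    + exact: distS_ge0.
    + by rewrite ge_max distS_ge0//= lerBlDr distS_near.
have glim x : g n x @[n --> \oo] --> ((distS (x : 'rV[R]_d) G) `^ p)%:E.
  apply: cvg_EFin; first exact: nearW.
  (* At distance 0 the truncations are constant in [n], so continuity of the power is required only
     at positive reals. *)
  have := distS_ge0 x G0; rewrite le_eqVlt => /predU1P[e|dx].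
    rewrite -e (_ : (fine \o _) = fun=> 0 `^ p); first exact: cvg_cst.
    by apply/funext => n; rewrite /= -e sub0r max_l// oppr_le0 ltW.
  apply: (cvg_comp (fun n => Num.max 0 (distS x G - z n)) (fun y => y `^ p));
    last exact: continuous_powR_base.
  have c : (distS x G - z n) @[n --> \oo] --> distS x G.
    by rewrite -[X in _ --> X]subr0; apply: cvgB => //; exact: cvg_cst.
  apply: cvg_trans c; apply: near_eq_cvg.
  move/cvgrPdist_lt : zc => /(_ _ dx); apply: filterS => n.
  rewrite sub0r normrN gtr0_norm// => zd.
  by rewrite max_r// subr_ge0 ltW.
have -> : (\int[mu]_(x in [set: BorelE R d]) ((distS (x : 'rV[R]_d) G) `^ p)%:E =
   \int[mu]_(x in [set: BorelE R d]) limn_einf (g ^~ x))%E.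
  by apply: eq_integral => x _; have [-> _] := cvg_limn_einf_sup (glim x).
apply: le_trans (fatou _ _ _ _) _ => //.
- by move=> n; exact: measurable_distS_powR.
- by move=> n x _; rewrite lee_fin powR_ge0.
have c : (fun n => (D + z n)%:E) @ \oo --> D%:E.
  apply: cvg_EFin; first exact: nearW.
  by rewrite -[X in _ --> X]addr0; apply: cvgD => //; exact: cvg_cst.
have [<- _] := cvg_limn_einf_sup c.
rewrite !limn_einf_lim; apply: lee_lim; [exact: is_cvg_einfs|exact: is_cvg_einfs|].
apply: nearW => n; apply: le_ereal_inf_tmp => _ [m /= nm <-].
by apply: le_trans (gint m); apply: ereal_inf_lbound; exists m.
Qed.

(* A curve far from the support has large fidelity, so fidelity and length
   bound the starting point. *)
Lemma start_bounded (R : realType) (d : nat)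
  (mu : {measure set (BorelE R d) -> \bar R}) (p Q L : R) (S : set 'rV[R]_d) :
  (0 < mu setT)%E -> (mu setT < +oo)%E -> compact S -> mu (~` S) = 0%E -> 1 <= p ->
  exists B, forall (b : R) (psi : R -> 'rV[R]_d), 0 <= b <= L ->
    (forall t, 0 <= t <= b -> enorm (psi t - psi 0) <= t) ->
    (\int[mu]_(x in [set: BorelE R d])
       ((distS (x : 'rV[R]_d) (curve_image b psi)) `^ p)%:E <= Q%:E)%E ->
    enorm (psi 0) <= B.
Proof.
move=> mu0 muoo cS muS p1.
have mS : measurable (~` S : set (BorelE R d)).
  apply: sub_sigma_algebra; apply: closed_openC.
  by apply: compact_closed => //; exact: norm_hausdorff.
have [M SM] : exists M, forall x, S x -> enorm x <= M.
  have : compact (@enorm R d @` S).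
    by apply: continuous_compact => //; apply: continuous_subspaceT; exact: continuous_enorm.
  move=> /compact_bounded[N [_ h]]; exists (N + 1) => x Sx.
  by apply: le_trans (ler_norm _) _; apply: (h (N + 1)); [rewrite ltrDl|exists x].
have mufin : mu setT \is a fin_num by rewrite ge0_fin_numE.
pose w := fine (mu setT).
have w0 : 0 < w by rewrite -lte_fin fineK.
(* Large enough that [r * w] exceeds [Q], and at least 1 so that [r <= r^p]. *)
pose r := `|Q| / w + 1.
have r1 : 1 <= r by rewrite lerDr divr_ge0// ltW.
have rw : Q < r * w.
  by rewrite /r mulrDl mul1r divfK ?gt_eqF//; have := ler_norm Q; lra.
(* The support has norms at most [M] and the curve travels at most [L], so a start beyond this bound
   leaves every curve point at distance at least [r] from the support. *)
exists (M + L + r) => b psi /andP[b0 bL] psil hQ.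
rewrite leNgt; apply/negP => far.
have G0 : curve_image b psi !=set0.
  by exists (psi 0); exists 0 => //=; rewrite in_itv/= lexx.
have : ((r * w)%:E <= Q%:E)%E; last by rewrite lee_fin leNgt rw.
apply: le_trans hQ.
have -> : (r * w)%:E = (\int[mu]_(x in [set: BorelE R d]) (cst r%:E) x)%E.
  by rewrite integral_cst// EFinM fineK.
apply: ae_ge0_le_integral => //.
- by move=> x _; rewrite lee_fin (le_trans _ r1).
- by move=> x _; rewrite lee_fin powR_ge0.
- have := @measurable_distS_powR R d _ p 0 G0.
  by apply: eq_measurable_fun => x _; rewrite subr0 max_r// distS_ge0.
exists (~` S); split => // x /= nh Sx; apply: nh => _.
rewrite lee_fin; have rd : r <= distS x (curve_image b psi).
  apply: le_distS => // y [t /=]; rewrite in_itv/= => t0b <-.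
  have /andP[t0 tb] := t0b.
  have h1 := psil t t0b; have h2 := SM x Sx.
  have h3 := enorm_triangle (psi 0) (psi t) 0.
  have h4 := enorm_triangle (psi t) x 0.
  move: h3 h4; rewrite !subr0 (enormC (psi 0)) (enormC (psi t) x) => h3 h4.
  lra.
apply: (@le_trans _ _ (r `^ p)).
  by rewrite -{1}(powRr1 (le_trans ler01 r1)) ler_powR.
by rewrite ge0_ler_powR ?nnegrE//; lra.
Qed.

(** * The minimizer *)

Lemma inC_point (R : realType) (d : nat) (phi : R -> 'rV[R]_d) : inC 0 phi.
Proof.
split=> //; split.
  exists 0 => s t /andP[s0 s0'] /andP[t0 t0'].
  have -> : s = 0 by apply/eqP; rewrite eq_le s0 s0'.
  have -> : t = 0 by apply/eqP; rewrite eq_le t0 t0'.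
  by rewrite subrr enorm0 mul0r.
by apply: aeW => t /andP[t0 t0']; have := lt_trans t0 t0'; rewrite ltxx.
Qed.

Lemma H2wit_point (R : realType) (d : nat) (c : 'rV[R]_d) :
  H2wit 0 (fun=> c) (fun=> 0) (fun=> 0).
Proof.
split; first by move=> j; exact: measurable_cst.
split; first by rewrite set_itv1 integral_set1.
by split => t _ j; rewrite /Rintegral mxE integral0 ?addr0.
Qed.

Lemma curv_energy_ge0 (R : realType) (d : nat) (a : R) (phi : R -> 'rV[R]_d) :
  (0 <= curv_energy a phi)%E.
Proof.
apply: le_ereal_inf_tmp => _ [k _ <-].
by apply: integral_ge0 => t _; rewrite lee_fin sqr_ge0.
Qed.

Lemma curv_energy_point (R : realType) (d : nat) (c : 'rV[R]_d) :
  curv_energy 0 (fun=> c) = 0%E.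
Proof.
apply/eqP; rewrite eq_le curv_energy_ge0 andbT; apply: ereal_inf_lbound.
exists (fun=> 0); first by exists (fun=> 0); exact: H2wit_point.
by rewrite set_itv1 integral_set1.
Qed.

Lemma fidelity_ge0 (R : realType) (d : nat)
  (mu : {measure set (BorelE R d) -> \bar R}) (p : R) (G : set 'rV[R]_d) :
  (0 <= \int[mu]_(x in [set: BorelE R d]) ((distS (x : 'rV[R]_d) G) `^ p)%:E)%E.
Proof. by apply: integral_ge0 => x _; rewrite lee_fin powR_ge0. Qed.

Lemma Energy_ge0 (R : realType) (d : nat)
  (mu : {measure set (BorelE R d) -> \bar R}) (lam eps p a : R) (phi : R -> 'rV[R]_d) :
  0 <= lam -> 0 <= eps -> (0 <= Energy mu lam eps p a phi)%E.
Proof.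
move=> l0 e0; rewrite /Energy; case: ifP => // /asboolP[[a0 _] _].
apply: adde_ge0; last by rewrite mule_ge0// curv_energy_ge0.
by apply: adde_ge0; [exact: fidelity_ge0|rewrite lee_fin mulr_ge0].
Qed.

Lemma curve_image_neq0 (R : realType) (d : nat) (a : R) (phi : R -> 'rV[R]_d) :
  0 <= a -> curve_image a phi !=set0.
Proof. by move=> a0; exists (phi 0), 0 => //=; rewrite in_itv/= lexx. Qed.

Lemma adde3_lt_fin (R : realType) (x y z : \bar R) (r : R) :
  (x + y + z < r%:E)%E -> (0 <= x)%E -> (0 <= y)%E -> (0 <= z)%E ->
  exists x' y' z' : R, [/\ 0 <= x', x = x'%:E, y = y'%:E, z = z'%:E &
    x' + y' + z' < r].
Proof.
case: x => [x| |]//; case: y => [y| |]//; case: z => [z| |]//.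
by rewrite -!EFinD lte_fin => h x0 _ _; exists x, y, z.
Qed.

(** The curvature term is an infimum over witnesses, so the chosen witness exceeds it by up to [e];
    this is the extra [eps * e]. *)
Lemma Energy_lt_tame (R : realType) (d : nat)
  (mu : {measure set (BorelE R d) -> \bar R}) (lam eps p m e b : R)
  (psi : R -> 'rV[R]_d) :
  (0 < d)%N -> 0 < lam -> 0 < eps -> 0 < e -> inC b psi ->
  (Energy mu lam eps p b psi < (m + e)%:E)%E ->
  exists v k K D, [/\ tame b K psi v k, 0 <= K, 0 <= D,
    (\int[mu]_(x in [set: BorelE R d])
       ((distS (x : 'rV[R]_d) (curve_image b psi)) `^ p)%:E = D%:E)%E &
    D + lam * b + eps * K <= m + e + eps * e].
Proof.
move=> d0 lam0 eps0 e0 Cpsi; rewrite /Energy; case: ifP => //= /asboolP[_ H2].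
have k0 := curv_energy_ge0 b psi.
move=> h; have [|||D [lb [ec [D0 FD lbE Eec hlt]]]] := adde3_lt_fin h.
- exact: fidelity_ge0.
- by rewrite lee_fin mulr_ge0 ?(ltW lam0)//; exact: Cpsi.1.
- by rewrite mule_ge0// lee_fin ltW.
case: lbE => lbE; rewrite -lbE in hlt.
have [c Ec Ek] : exists2 c, ec = eps * c & curv_energy b psi = c%:E.
  case Ek : (curv_energy b psi) Eec k0 => [c| |]//.
    by rewrite -EFinM => -[<-] _; exists c.
  by rewrite gt0_muley ?lte_fin.
rewrite Ec in hlt.
have : (curv_energy b psi < (c + e)%:E)%E by rewrite Ek lte_fin ltrDl.
move=> /ereal_inf_lt[_ [kap [v wit] <-] kc].
have Ige0 : (0 <= \int[@lebesgue_measure R]_(t in `[0%R, b]) ((enorm (kap t)) ^+ 2)%:E)%E.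
  by apply: integral_ge0 => t _; rewrite lee_fin sqr_ge0.
case EK : (\int[@lebesgue_measure R]_(t in `[0%R, b]) ((enorm (kap t)) ^+ 2)%:E)%E
  Ige0 kc => [K| |]//.
rewrite lee_fin lte_fin => K0 Kc.
have [v' [k tm]] := H2wit_tame d0 Cpsi wit EK.
exists v', k, K, D; split => //.
have : eps * K <= eps * (c + e) by rewrite ler_wpM2l// ltW.
rewrite mulrDr; lra.
Qed.

Unset Implicit Arguments. Set Strict Implicit.

Theorem theorem2p4 (R : realType) (d : nat)
  (mu : {measure set (BorelE R d) -> \bar R}) (lam eps p : R) :
  (2 <= d)%N ->
  (mu setT < +oo)%E ->
  (exists K : set 'rV[R]_d, compact K /\ mu (~` K) = 0%E) ->
  0 < lam -> 0 < eps -> 1 <= p ->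
  exists (a : R) (phi : R -> 'rV[R]_d),
    inC a phi /\
    forall (b : R) (psi : R -> 'rV[R]_d), inC b psi ->
      (Energy mu lam eps p a phi <= Energy mu lam eps p b psi)%E.
Proof.
move=> d2 muoo [S [cS muS]] lam0 eps0 p1.
have d0 : (0 < d)%N by exact: leq_trans d2.
have En0 b psi := @Energy_ge0 R d mu lam eps p b psi (ltW lam0) (ltW eps0).
(* With zero measure nothing prevents minimizing sequences from escaping to infinity, but a single
   point has energy 0. *)
have [mu0|mun0] := eqVneq (mu setT) 0%E.
  exists 0, (fun=> 0); split; first exact: inC_point.
  move=> b psi _; apply: le_trans (En0 b psi).
  rewrite /Energy; case: ifP => [_|/asboolP[]]; last first.
    by split; [exact: inC_point|exists (fun=> 0), (fun=> 0); exact: H2wit_point].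
  rewrite curv_energy_point mule0 mulr0 !adde0.
  rewrite (null_set_integral _ _ mu0)//.
  have := @measurable_distS_powR R d _ p 0 (curve_image_neq0 (fun=> 0) (lexx 0)).
  by apply: eq_measurable_fun => x _; rewrite subr0 max_r// distS_ge0//;
    exact: curve_image_neq0.
have {mun0} mu0 : (0 < mu setT)%E by rewrite lt_def mun0/=.
pose Es := [set Energy mu lam eps p bp.1 bp.2 | bp in
   [set bp : R * (R -> 'rV[R]_d) | inC bp.1 bp.2]].
have EsP b psi : inC b psi -> (ereal_inf Es <= Energy mu lam eps p b psi)%E.
  by move=> Cp; apply: ereal_inf_lbound; exists (b, psi).
have inf0 : (0 <= ereal_inf Es)%E by apply: le_ereal_inf_tmp => _ [bp _ <-]; exact: En0.
(* If the infimum is infinite, every curve has infinite energy and any curve is a minimizer. *)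
case Em : (ereal_inf Es) inf0 => [m| |]//; last first.
  exists 0, (fun=> 0); split; first exact: inC_point.
  by move=> b psi /EsP; rewrite Em leye_eq => /eqP->; exact: leey.
rewrite lee_fin => m0.
pose z n : R := n.+1%:R^-1.
have z0 n : 0 < z n by rewrite invr_gt0.
have z1 n : z n <= 1 by rewrite invf_le1// ler1n.
have /choice[q qP] n : exists q :
    (R * (R -> 'rV[R]_d)) * ((R -> 'rV[R]_d) * ('I_d -> R -> R)) * (R * R),
   let: (b, psi, (v, k), (K, D)) := q in
   [/\ 0 <= b, tame b K psi v k, 0 <= K, 0 <= D &
    ((\int[mu]_(x in [set: BorelE R d])
       ((distS (x : 'rV[R]_d) (curve_image b psi)) `^ p)%:E = D%:E)%E /\
    D + lam * b + eps * K <= m + z n + eps * z n)].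
  have : (ereal_inf Es < (m + z n)%:E)%E by rewrite Em lte_fin ltrDl.
  move=> /ereal_inf_lt[_ [[b psi] /= Cp <-] /(Energy_lt_tame d0 lam0 eps0 (z0 n) Cp)].
  move=> [v [k [K [D [tm K0 D0 FD sm]]]]].
  exists (b, psi, (v, k), (K, D)); split => //; exact: Cp.1.
pose A n := (q n).1.1.1; pose phi n := (q n).1.1.2.
pose v n := (q n).1.2.1; pose k n := (q n).1.2.2.
pose K n := (q n).2.1; pose D n := (q n).2.2.
have {}qP n : [/\ 0 <= A n, tame (A n) (K n) (phi n) (v n) (k n), 0 <= K n, 0 <= D n &
    ((\int[mu]_(x in [set: BorelE R d])
       ((distS (x : 'rV[R]_d) (curve_image (A n) (phi n))) `^ p)%:E = (D n)%:E)%E /\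
    D n + lam * A n + eps * K n <= m + z n + eps * z n)].
  by move: (qP n); rewrite /A /phi /v /k /K /D; case: (q n) => [[[? ?] [? ?]] [? ?]].
(* Since [z n <= 1], this bounds the whole sum, hence each of its three nonnegative terms. *)
pose Q := m + 1 + eps.
have bnd n : [/\ D n <= Q, lam * A n <= Q & eps * K n <= Q].
  have [A0 _ K0 D0 [_ h]] := qP n.
  have lA := mulr_ge0 (ltW lam0) A0; have eK := mulr_ge0 (ltW eps0) K0.
  have ez : eps * z n <= eps by rewrite ler_piMr// ltW.
  have := z1 n; rewrite /Q; split; lra.
have A_itv n : 0 <= A n <= Q / lam.
  have [A0 _ _ _ _] := qP n; have [_ h _] := bnd n.
  by rewrite A0/= ler_pdivlMr// mulrC.
have K_itv n : 0 <= K n <= Q / eps.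
  have [_ _ K0 _ _] := qP n; have [_ _ h] := bnd n.
  by rewrite K0/= ler_pdivlMr// mulrC.
have D_itv n : 0 <= D n <= Q.
  by have [_ _ _ -> _] := qP n; have [-> _ _] := bnd n.
have [B hB] := @start_bounded R d mu p Q (Q / lam) S mu0 muoo cS muS p1.
have phiB n : enorm (phi n 0) <= B.
  have [A0 tm _ _ [FD _]] := qP n; apply: (hB (A n)) => //.
    by move=> t /andP[t0 tA]; have [_ _ h _ _] := tm;
      have := h 0 t (lexx _) t0 tA; rewrite subr0.
  by rewrite FD lee_fin; have [] := bnd n.
(* [U] refines the filter of cofinite sets, so ordinary limits such as that of [z] persist along
   it. *)
have [U [UU oU]] := ultraFilterLemma (eventually_filter : ProperFilter \oo).
have PU : ProperFilter U by exact: ultra_proper.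
have [a Aa] := ultra_cvg_real UU A_itv.
have [Ki KKi] := ultra_cvg_real UU K_itv.
have [Di DDi] := ultra_cvg_real UU D_itv.
have tm n : tame (A n) (K n) (phi n) (v n) (k n) by have [] := qP n.
have [Phi [CPhi H2Phi curvPhi near_phi]] := tame_limit UU A_itv tm phiB Aa KKi.
(* Only the sum is compared with the infimum; the three limits need not be optimal separately. *)
have sum_le : Di + lam * a + eps * Ki <= m.
  have zc : z n @[n --> U] --> (0 : R) by apply: cvg_trans (@cvg_harmonic R) => P /oU.
  have c1 : (D n + lam * A n + eps * K n) @[n --> U] --> Di + lam * a + eps * Ki.
    by apply: cvgD; [apply: cvgD => //|]; exact: cvgMr.
  have c2 : (m + z n + eps * z n) @[n --> U] --> m + 0 + eps * 0.
    by apply: cvgD; [apply: cvgD => //; exact: cvg_cst|exact: cvgMr].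
  have := ler_cvg_to c1 c2; rewrite mulr0 !addr0; apply.
  by apply: nearW => n; have [_ _ _ _ []] := qP n.
have fid : (\int[mu]_(x in [set: BorelE R d])
    ((distS (x : 'rV[R]_d) (curve_image a Phi)) `^ p)%:E <= Di%:E)%E.
  apply: fidelity_le; [exact: lt_le_trans p1|exact: curve_image_neq0 CPhi.1|].
  move=> e e0; move/cvgrPdist_lt : DDi => /(_ e e0) nD.
  have [n [nD' nphi]] := filter_ex (filterI nD (near_phi e e0)).
  have [A0 _ _ _ [FD _]] := qP n.
  exists (curve_image (A n) (phi n)); split.
  - exact: curve_image_neq0.
  - move=> y [t /=]; rewrite in_itv/= => tA <-.
    have [s sa hs] := nphi t tA; exists (Phi s) => //.
    by exists s => //=; rewrite in_itv.
  - by rewrite FD lee_fin; move: nD'; rewrite ltr_norml => /andP[? ?]; lra.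
exists a, Phi; split => // b psi /EsP; apply: le_trans; rewrite Em.
rewrite /Energy; case: ifP => [_|/asboolP[]//].
apply: (@le_trans _ _ (Di + lam * a + eps * Ki)%:E); last by rewrite lee_fin.
rewrite !EFinD; apply: leeD; first by apply: leeD.
by rewrite EFinM; apply: lee_wpmul2l => //; rewrite lee_fin ltW.
Qed.
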